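(* There exist an absolute constant $C>0$ and positive-integer-valued functions $\zeta = \zeta(k,\delta)$ and $d = d(k,\delta)$, defined for integers $k\ge 1$ and $\delta\in(0,1)$, with $\zeta\le d$ and $$\zeta(k,\delta) \le C\,(1+\log(k/\delta)), \qquad d(k,\delta) \le C\,k\,(1+\log(k/\delta)),$$ such that the following holds. Let $\delta\in(0,1)$ and $\epsilon\in(0,1)$. Let $A\in\mathbb{R}^{N\times N}$ be any (symmetric) positive-semidefinite matrix, let $S\subseteq\{1,\dots,N\}$ be an index set of cardinality $|S| = k\ge 1$, and let $\mu>0$. Define $$M = A(S,:)\,A(:,S) + \mu\,A(S,S)$$ and assume that $M$ is nonsingular. Let $\Phi\in\mathbb{R}^{d\times N}$ be a sparse random sign embedding with column sparsity $\zeta=\zeta(k,\delta)$ and embedding dimension $d=d(k,\delta)$, and define the preconditioner $$P = A(S,:)\,\Phi^*\Phi\,A(:,S) + \mu\,A(S,S).$$ Then, with probability at least $1-\delta$ over $\Phi$, $$\kappa\bigl(P^{-1/2} M P^{-1/2}\bigr)\le 3. \qquad (\ast)$$ Moreover, whenever the event $(\ast)$ occurs, the following holds for every $y\in\mathbb{R}^N$. Let $\hat\beta = M^{-1}A(S,:)y$, and let $\hat\beta^{(t)}$ be the $t$-th iterate of the conjugate gradient method with preconditioner $P$ and zero initial iterate, applied to the linear system $M\hat\beta = A(S,:)y$. Then $$\lVert \hat\beta^{(t)}-\hat\beta\rVert_M \le \epsilon\,\lVert\hat\beta\rVert_M$$ for every iteration $t\ge\log(2/\epsilon)$.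
   Context: Notation. $\log$ is the natural logarithm and $^*$ denotes transpose. $A(:,S)$ is the submatrix of $A$ with columns indexed by $S$, $A(S,:)$ the submatrix with rows indexed by $S$, and $A(S,S)$ the submatrix with rows and columns indexed by $S$. $\kappa(M)=\lVert M\rVert\,\lVert M^{-1}\rVert$ is the condition number in the spectral norm. For positive-definite $M$, $\lVert z\rVert_M=(z^*Mz)^{1/2}$. Sparse random sign embedding. Given positive integers $\zeta\le d$ and $N$, the sparse random sign embedding $\Phi\in\mathbb{R}^{d\times N}$ with column sparsity $\zeta$ is generated as follows. Independently for each column, sample $\zeta$ row indices uniformly at random without replacement from $\{1,\dots,d\}$, and place in the corresponding entries independent Rademacher ($\pm1$ with probability $1/2$ each) variables scaled by $\zeta^{-1/2}$; all other entries of the column are zero. Preconditioned conjugate gradient (PCG). For a system $Mz=b$ with $M$ positive definite and a positive-definite preconditioner $P$, PCG with zero initial iterate is equivalent to conjugate gradient applied to the matrix $P^{-1/2}MP^{-1/2}$. Its $t$-th iterate $z^{(t)}$ is the unique minimizer of $\lVert w-z\rVert_M$ over $w$ in the Krylov subspace $\operatorname{span}\{(P^{-1}M)^jP^{-1}b : 0\le j\le t-1\}$, where $z=M^{-1}b$ (in exact arithmetic; $z^{(0)}=0$, and once the exact solution is reached the iterates remain there). *)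

(* Defs.v *)
From mathcomp Require Import all_boot all_order all_algebra.
From mathcomp Require Import all_classical all_reals all_analysis.

Set Implicit Arguments.
Unset Strict Implicit.
Unset Printing Implicit Defensive.

Import Order.TTheory GRing.Theory Num.Theory.

Local Open Scope classical_set_scope.
Local Open Scope ring_scope.

Section LinearAlgebra.
Context {R : realType}.

Definition psdmx n (A : 'M[R]_n) : Prop :=
  A^T = A /\ forall x : 'cV[R]_n, 0 <= (x^T *m A *m x) 0 0.

Definition posdefmx n (A : 'M[R]_n) : Prop :=
  A^T = A /\ forall x : 'cV[R]_n, x != 0 -> 0 < (x^T *m A *m x) 0 0.

Definition l2norm n (x : 'cV[R]_n) : R := Num.sqrt (\sum_i x i 0 ^+ 2).

Definition energy_norm n (M : 'M[R]_n) (z : 'cV[R]_n) : R :=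
  Num.sqrt ((z^T *m M *m z) 0 0).

Definition spectral_norm m n (A : 'M[R]_(m, n)) : R :=
  sup [set l2norm (A *m x) | x in [set x : 'cV[R]_n | l2norm x <= 1]].

(* Only meaningful for invertible [A], since [invmx A = A] otherwise. *)
Definition cond_number n (A : 'M[R]_n) : R :=
  spectral_norm A * spectral_norm (invmx A).

(* [Q] is P^{-1/2}.  If [P] is singular then [invmx P = P] and no positive
   definite [Q] satisfies this, so the relation holds for at most one [Q], and
   for some [Q] exactly when [P] is positive definite. *)
Definition is_invsqrtmx n (P Q : 'M[R]_n) : Prop :=
  posdefmx Q /\ Q *m Q = invmx P.

(* kappa(P^{-1/2} M P^{-1/2}) <= c, where P^{-1/2} is required to exist. *)
Definition precond_cond_le n (P M : 'M[R]_n) (c : R) : Prop :=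
  exists Q : 'M[R]_n, is_invsqrtmx P Q /\ cond_number (Q *m M *m Q) <= c.

(* Rows and columns are enumerated in increasing order of their indices. *)
Definition rows_of m n (S : {set 'I_m}) (A : 'M[R]_(m, n)) : 'M[R]_(#|S|, n) :=
  rowsub (fun i : 'I_#|S| => enum_val i) A.

Definition cols_of m n (S : {set 'I_n}) (A : 'M[R]_(m, n)) : 'M[R]_(m, #|S|) :=
  colsub (fun j : 'I_#|S| => enum_val j) A.

Definition reg_normal_mx N (A : 'M[R]_N) (S : {set 'I_N}) (mu : R)
    : 'M[R]_#|S| :=
  rows_of S A *m cols_of S A + mu *: rows_of S (cols_of S A).

Definition sketched_precond N d (A : 'M[R]_N) (S : {set 'I_N}) (mu : R)
    (Phi : 'M[R]_(d, N)) : 'M[R]_#|S| :=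
  rows_of S A *m Phi^T *m Phi *m cols_of S A + mu *: rows_of S (cols_of S A).

Definition krylov n (P M : 'M[R]_n) (b : 'cV[R]_n) (t : nat)
    : {vspace 'cV[R]_n} :=
  <<[seq (invmx P *m M) ^+ j *m (invmx P *m b) | j <- iota 0 t]>>%VS.

Definition is_pcg_iterate n (P M : 'M[R]_n) (b : 'cV[R]_n) (t : nat)
    (w : 'cV[R]_n) : Prop :=
  w \in krylov P M b t /\
  forall w', w' \in krylov P M b t ->
    energy_norm M (w - invmx M *m b) <= energy_norm M (w' - invmx M *m b).

(* The minimizer exists and is unique when [M] and [P] are positive definite;
   the default value 0 is used only when there is none. *)
Definition pcg_iterate n (P M : 'M[R]_n) (b : 'cV[R]_n) (t : nat)
    : 'cV[R]_n :=
  xget 0 [set w | is_pcg_iterate P M b t w].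

End LinearAlgebra.

(* The random sign embedding is the image of the uniform distribution on a
   finite set of seeds.  A seed gives, for each column, the [zeta]-subset of its
   nonzero rows and one sign per row; signs outside the subset are not used.
   As the set of seeds is a product over the columns, uniformity says that the
   columns are independent, each with a uniform [zeta]-subset and independent
   fair signs that are independent of the subset. *)
Definition sign_seed (d N : nat) : finType :=
  {ffun 'I_N -> {set 'I_d} * {ffun 'I_d -> bool}}.

Definition sign_seeds (d N zeta : nat) : {set sign_seed d N} :=
  [set s : sign_seed d N | [forall j, #|(s j).1| == zeta]].

Definition sparse_sign_mx (R : realType) (d N zeta : nat) (s : sign_seed d N)
    : 'M[R]_(d, N) :=
  \matrix_(i, j) (if i \in (s j).1
                  then (-1) ^+ (s j).2 i / Num.sqrt zeta%:R else 0).

Definition sparse_sign_prob (R : realType) (d N zeta : nat)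
    (E : 'M[R]_(d, N) -> Prop) : R :=
  #|[set s in sign_seeds d N zeta | `[< E (sparse_sign_mx R zeta s) >]]|%:R
  / #|sign_seeds d N zeta|%:R.

(* Main.v *)
Require Import Defs.
From mathcomp Require Import all_boot all_order all_algebra all_fingroup.
From mathcomp Require Import all_classical all_reals all_analysis.
From mathcomp Require Import complex ring lra.

(* Write B = A(:,S) and let U be an orthonormal basis of its range.  If
   |Phi U v|^2 is within a factor 1/2 of |v|^2 for all v, then
   M / 2 <= P <= 3 M / 2 and the condition number is at most 3; the Chebyshev
   polynomials on [a, 3a] then give the rate 2 / 3^t for conjugate gradients.

   For the embedding, take d = 2 k zeta and let u_j be the rows of U.  Up to
   the factor 1 / zeta, the deviation is the sum over the rows r of Phi of
   X_r = z z^T - V, where z is the signed sum, and V the covariance sum, of the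
   u_j over the columns j that hit r.  The rows are dependent, so each half of
   them is peeled row by row, with tr exp (c sum X_r) summed over all seeds as
   the potential.  As long as at most half of the rows has been revealed, any
   further row is hit by a given column with conditional probability at most
   zeta / (d / 2) = 1 / k.  Golden-Thompson and a bound on the exponential
   moments of Rademacher sums then show that one row multiplies the potential
   by at most 1 + O(c^2 / k), whence exp (O(c^2) zeta) after k zeta rows, while
   a deviation of zeta / 4 costs exp (c zeta / 4). *)

Set Implicit Arguments.
Unset Strict Implicit.
Unset Printing Implicit Defensive.

Import Order.TTheory GRing.Theory Num.Theory.
Import numFieldNormedType.Exports.

Local Open Scope ring_scope.

(** * Quadratic forms and the spectral theorem *)

Section QuadraticForms.
Context {R : realType}.

(** A row may be hit by many columns, so |z|^2 has no useful uniform bound and X_r no bounded norm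
    to feed a Bernstein argument. The signs are therefore averaged for fixed hits, at the cost of a
    factor exp (sum of |u_j|^2 over the hits), and this factor is averaged over the hits afterwards.
    Since the |u_j|^2 add up to k and a hit has conditional probability at most 1 / k, only an
    absolute constant is lost.

    Conditional probabilities never appear as such. Probabilities are counts of seeds, and fresh
    signs or exchangeable rows are expressed by involutions of the seed set: flipping the signs of
    one row, or transposing two rows within one column. Golden-Thompson is enough because one row is
    split off at a time, while the exponential of the earlier rows stays in place as a positive
    weight. *)

Definition qf n (A : 'M[R]_n) (x : 'cV[R]_n) : R := (x^T *m A *m x) 0 0.
Definition sqn n (x : 'cV[R]_n) : R := \sum_i x i 0 ^+ 2.

Lemma trmxZ m n a (A : 'M[R]_(m, n)) : (a *: A)^T = a *: A^T.
Proof. by apply/matrixP => i j; rewrite !mxE. Qed.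

Lemma qf1 n (x : 'cV[R]_n) : qf 1%:M x = sqn x.
Proof.
rewrite /qf mulmx1 mxE; apply: eq_bigr => i _.
by rewrite !mxE expr2.
Qed.

Lemma sqnE n (x : 'cV[R]_n) : (x^T *m x) 0 0 = sqn x.
Proof. by rewrite -qf1 /qf mulmx1. Qed.

Lemma sqn_ge0 n (x : 'cV[R]_n) : 0 <= sqn x.
Proof. by apply: sumr_ge0 => i _; exact: sqr_ge0. Qed.

Lemma sqn_eq0 n (x : 'cV[R]_n) : (sqn x == 0) = (x == 0).
Proof.
apply/idP/eqP => [|->]; last first.
  by rewrite /sqn big1 // => i _; rewrite mxE expr0n.
rewrite psumr_eq0 => [/allP h|i _]; last exact: sqr_ge0.
apply/matrixP => i j; rewrite ord1 mxE.
by have := h i (mem_index_enum _); rewrite /= sqrf_eq0 => /eqP.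
Qed.

Lemma sqn_gt0 n (x : 'cV[R]_n) : (0 < sqn x) = (x != 0).
Proof. by rewrite lt_neqAle sqn_ge0 andbT eq_sym sqn_eq0. Qed.

Lemma qfD n (A B : 'M[R]_n) x : qf (A + B) x = qf A x + qf B x.
Proof. by rewrite /qf mulmxDr mulmxDl mxE. Qed.

Lemma qfN n (A : 'M[R]_n) x : qf (- A) x = - qf A x.
Proof. by rewrite /qf mulmxN mulNmx mxE. Qed.

Lemma qfZ n a (A : 'M[R]_n) x : qf (a *: A) x = a * qf A x.
Proof. by rewrite /qf -scalemxAr -scalemxAl mxE. Qed.

Lemma qf0 n x : qf (0 : 'M[R]_n) x = 0.
Proof. by rewrite /qf mulmx0 mul0mx mxE. Qed.

Lemma qf_sum n I (r : seq I) (P : pred I) (F : I -> 'M[R]_n) x :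
  qf (\sum_(i <- r | P i) F i) x = \sum_(i <- r | P i) qf (F i) x.
Proof. by apply: (big_morph (fun A => qf A x) (fun A B => qfD A B x) (qf0 x)). Qed.

Lemma qf_conj n m (B : 'M[R]_(n, m)) (A : 'M[R]_n) x :
  qf (B^T *m A *m B) x = qf A (B *m x).
Proof. by rewrite /qf trmx_mul !mulmxA. Qed.

Lemma qf_scale n (A : 'M[R]_n) a x : qf A (a *: x) = a ^+ 2 * qf A x.
Proof.
by rewrite /qf -scalemxAr trmxZ -!scalemxAl !mxE mulrA expr2.
Qed.

Lemma sqn_scale n a (x : 'cV[R]_n) : sqn (a *: x) = a ^+ 2 * sqn x.
Proof. by rewrite -!qf1 qf_scale. Qed.

Definition inner n (x y : 'cV[R]_n) : R := (x^T *m y) 0 0.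

Lemma innerE n (x y : 'cV[R]_n) : inner x y = \sum_i x i 0 * y i 0.
Proof. by rewrite /inner mxE; apply: eq_bigr => i _; rewrite mxE. Qed.

Lemma innerC n (x y : 'cV[R]_n) : inner x y = inner y x.
Proof. by rewrite !innerE; apply: eq_bigr => i _; rewrite mulrC. Qed.

Lemma qf_outer n (u x : 'cV[R]_n) : qf (u *m u^T) x = inner u x ^+ 2.
Proof.
rewrite /qf mulmxA -mulmxA (mx11_scalar (u^T *m x)) mul_mx_scalar mxE.
by rewrite -/(inner x u) -/(inner u x) (innerC x u) expr2.
Qed.

Lemma qf_diag n (d : 'rV[R]_n) x : qf (diag_mx d) x = \sum_i d 0 i * x i 0 ^+ 2.
Proof.
rewrite /qf -mulmxA mxE; apply: eq_bigr => i _.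
by rewrite mul_diag_mx !mxE; ring.
Qed.

End QuadraticForms.

Section Spectral.
Context {R : realType}.

(** The spectral theorem over the complex numbers supplies a real eigenvalue; as a root of the
    characteristic polynomial it descends to [R], where it has an eigenvector of its own. *)
Lemma symmetric_real_eigenvector n (A : 'M[R]_n.+1) : A^T = A ->
  exists (l : R) (v : 'cV[R]_n.+1), v != 0 /\ A *m v = l *: v.
Proof.
move=> symA.
pose f := real_complex R.
pose B := map_mx f A.
have hB : B \is hermsymmx.
  apply: realsym_hermsym.
    by apply/is_hermitianmxP; rewrite expr0 scale1r map_mx_id // /B map_trmx symA.
  by apply/mxOverP => i j; rewrite mxE complex_real.
have /orthomx_spectralP BE := hermitian_normalmx hB.
have /mxOverP/(_ 0 0)/complex_realP[l lE] := hermitian_spectral_diag_real hB.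
have Pu := spectral_unit B.
have : eigenvalue A l.
  rewrite eigenvalue_root_char -(fmorph_root f) map_char_poly -eigenvalue_root_char.
  apply/eigenvalueP; exists (row 0 (spectralmx B)).
    rewrite -/B -row_mul {2}BE !mulmxA mulmxV // mul1mx row_mul row_diag_mx.
    by rewrite -scalemxAl -rowE lE.
  apply/negP => /eqP r0.
  have := congr1 (mulmx^~ (invmx (spectralmx B))) r0.
  rewrite -row_mul mulmxV // mul0mx => /matrixP/(_ 0 0).
  by rewrite !mxE /= => /eqP; rewrite oner_eq0.
move=> /eigenvalueP[v vA v0]; exists l, v^T; split.
  by apply: contraNneq v0 => /(congr1 trmx); rewrite trmxK trmx0 => ->.
by rewrite -{1}symA -trmx_mul vA linearZ.
Qed.

(** [H] is the reflection in the hyperplane orthogonal to [e - v], which exchanges the unit vectors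
    [e] and [v]. *)
Lemma householder n (v : 'cV[R]_n.+1) : sqn v = 1 ->
  exists H : 'M[R]_n.+1, [/\ H^T = H, H *m H = 1%:M & H *m delta_mx 0 0 = v].
Proof.
move=> v1; set e := delta_mx 0 0 : 'cV[R]_n.+1; pose w := e - v.
have ew : (w^T *m e) 0 0 = 1 - v 0 0.
  by rewrite -colE !mxE eqxx.
have ee : sqn e = 1.
  rewrite /sqn (bigD1 0) //= big1 => [|i i0]; first by rewrite !mxE eqxx expr1n addr0.
  by rewrite !mxE (negPf i0) expr0n.
have ww : sqn w = 2 * (1 - v 0 0).
  rewrite -sqnE {2}/w mulmxBr mxE [X in _ + X]mxE ew /w linearB /= mulmxBl mxE [X in - (_ + X)]mxE.
  by rewrite sqnE v1 /e trmx_delta -rowE !mxE; ring.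
have [w0|wN0] := eqVneq w 0.
  exists 1%:M; rewrite trmx1 !mulmx1 mul1mx; split => //.
  by move/eqP: w0; rewrite subr_eq0 => /eqP.
have sw : sqn w != 0 by rewrite sqn_eq0.
exists (1%:M - (2 / sqn w) *: (w *m w^T)); split.
- by rewrite linearB /= linearZ /= trmx_mul trmxK trmx1.
- rewrite mulmxBl mul1mx mulmxBr mulmx1 -scalemxAl -scalemxAr.
  rewrite !mulmxA -[w *m w^T *m w]mulmxA (mx11_scalar (w^T *m w)) sqnE mul_mx_scalar.
  rewrite -scalemxAl !scalerA opprB -[RHS]addr0 -addrA; congr (_ + _).
  rewrite addrC -addrA -opprD -!scalerDl -scalerBl.
  rewrite (_ : _ - _ = 0) ?scale0r //= /GRing.scale /=; by field.
- rewrite mulmxBl mul1mx -scalemxAl -mulmxA (mx11_scalar (w^T *m e)) ew mul_mx_scalar.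
  rewrite scalerA (_ : _ * _ = 1) ?scale1r; last by rewrite (_ : 1 - v 0 0 = sqn w / 2); [field | rewrite ww; field].
  by rewrite /w opprB addrC subrK.
Qed.

(** Induction on the size: conjugating by the reflection that sends the first basis vector to a unit
    eigenvector isolates the eigenvalue in the corner. *)
Lemma spectral_theorem n (A : 'M[R]_n) : A^T = A ->
  exists (Q : 'M[R]_n) (d : 'rV[R]_n), Q^T *m Q = 1%:M /\ A = Q^T *m diag_mx d *m Q.
Proof.
elim: n A => [|n IH] A symA.
  by exists 1%:M, 0; split; apply/matrixP => -[].
have [l [v [v0 Av]]] := symmetric_real_eigenvector symA.
have sv : 0 < sqn v by rewrite sqn_gt0.
pose u := (Num.sqrt (sqn v))^-1 *: v.
have u1 : sqn u = 1.
  by rewrite /u sqn_scale exprVn sqr_sqrtr ?ltW // mulVf // gt_eqF.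
have Au : A *m u = l *: u by rewrite /u -scalemxAr Av scalerA mulrC -scalerA.
have [H [HT HH He]] := householder u1.
pose B : 'M[R]_(1 + n) := H *m A *m H.
have BT : B^T = B by rewrite /B !trmx_mul HT symA mulmxA.
have Be : B *m delta_mx 0 0 = l *: delta_mx 0 0 :> 'cV_(1 + n).
  by rewrite /B -!mulmxA He Au -scalemxAr -He mulmxA HH mul1mx.
have -> : A = H *m B *m H by rewrite /B !mulmxA HH mul1mx -mulmxA HH mulmx1.
clearbody B.
have B1 : ulsubmx B = l%:M.
  apply/matrixP => i j; rewrite !ord1.
  have /matrixP/(_ 0 0) := Be; rewrite -colE !mxE !eqxx mulr1 mulr1n => <-.
  by congr (B _ _); apply: val_inj.
have B2 : dlsubmx B = 0.
  apply/matrixP => i j; rewrite !ord1 !mxE.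
  have /matrixP/(_ (rshift 1 i) 0) := Be; rewrite -colE !mxE /= mulr0 => <-.
  by congr (B _ _); apply: val_inj.
have B3 : ursubmx B = 0 by rewrite -[LHS]trmxK trmx_ursub BT B2 trmx0.
have [Q [d [QQ dE]]] : exists (Q : 'M[R]_n) (d : 'rV[R]_n),
    Q^T *m Q = 1%:M /\ drsubmx B = Q^T *m diag_mx d *m Q.
  by apply: IH; rewrite trmx_drsub BT.
have BE : B = block_mx l%:M 0 0 (drsubmx B) by rewrite -[LHS]submxK B1 B2 B3.
pose K : 'M[R]_(1 + n) := block_mx 1%:M 0 0 Q.
have KT : K^T = block_mx 1%:M 0 0 Q^T by rewrite tr_block_mx !trmx0 trmx1.
pose D : 'rV[R]_(1 + n) := row_mx l%:M d.
have KK : K^T *m K = 1%:M.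
  rewrite KT mulmx_block !(mul0mx, mulmx0, mulmx1, addr0, add0r) QQ.
  by rewrite -scalar_mx_block.
have KB : B = K^T *m diag_mx D *m K.
  rewrite KT diag_mx_row BE {1}dE !mulmx_block.
  rewrite !(mul0mx, mulmx0, mulmx1, mul1mx, addr0, add0r).
  by congr block_mx; apply/matrixP => i j; rewrite !ord1 !mxE.
exists (K *m (H : 'M[R]_(1 + n))), D; rewrite trmx_mul HT; split.
  by rewrite mulmxA -(mulmxA _ K^T) KK mulmx1.
by rewrite {1}KB !mulmxA.
Qed.

End Spectral.

(** * Functional calculus and the matrix exponential *)

Section FunctionalCalculus.
Context {R : realType}.
Local Open Scope classical_set_scope.

(** One diagonalisation is chosen per matrix, so that all [funsym f A] share an eigenbasis. The
    default is taken exactly when [A] is not symmetric. *)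
Definition eigen_pair n (A : 'M[R]_n) : 'M[R]_n * 'rV[R]_n :=
  xget (1%:M, 0) [set p | p.1^T *m p.1 = 1%:M /\ A = p.1^T *m diag_mx p.2 *m p.1].

Definition funsym (f : R -> R) n (A : 'M[R]_n) : 'M[R]_n :=
  (eigen_pair A).1^T *m diag_mx (map_mx f (eigen_pair A).2) *m (eigen_pair A).1.

Lemma funsymP n (A : 'M[R]_n) : A^T = A ->
  exists (Q : 'M[R]_n) (d : 'rV[R]_n),
    [/\ Q^T *m Q = 1%:M, Q *m Q^T = 1%:M, A = Q^T *m diag_mx d *m Q &
        forall f, funsym f A = Q^T *m diag_mx (map_mx f d) *m Q].
Proof.
move=> /spectral_theorem [Q [d h]].
have [QQ AE] : [set p | p.1^T *m p.1 = 1%:M /\ A = p.1^T *m diag_mx p.2 *m p.1] (eigen_pair A).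
  by apply: xgetPex; exists (Q, d).
exists (eigen_pair A).1, (eigen_pair A).2; split => //; exact: mulmx1C.
Qed.

Lemma qf_spectral n (Q : 'M[R]_n) (d : 'rV[R]_n) x :
  qf (Q^T *m diag_mx d *m Q) x = \sum_i d 0 i * (Q *m x) i 0 ^+ 2.
Proof. by rewrite qf_conj qf_diag. Qed.

Lemma sqn_orthogonal m n (Q : 'M[R]_(m, n)) x : Q^T *m Q = 1%:M -> sqn (Q *m x) = sqn x.
Proof. by move=> QQ; rewrite -sqnE trmx_mul mulmxA -(mulmxA x^T) QQ mulmx1 sqnE. Qed.

Lemma entry_spectral n (Q : 'M[R]_n) (d : 'rV[R]_n) i j :
  (Q^T *m diag_mx d *m Q) i j = \sum_l d 0 l * (Q l i * Q l j).
Proof.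
rewrite mxE; apply: eq_bigr => l _.
by rewrite mul_mx_diag !mxE; ring.
Qed.

Lemma mul_spectral n (Q : 'M[R]_n) (d e : 'rV[R]_n) : Q *m Q^T = 1%:M ->
  (Q^T *m diag_mx d *m Q) *m (Q^T *m diag_mx e *m Q) =
  Q^T *m diag_mx (\row_i (d 0 i * e 0 i)) *m Q.
Proof.
move=> QQ; rewrite !mulmxA -(mulmxA _ Q) QQ mulmx1; congr (_ *m _).
rewrite -mulmxA; congr (_ *m _); exact: mulmx_diag.
Qed.

Lemma sym_spectral n (Q : 'M[R]_n) (d : 'rV[R]_n) :
  (Q^T *m diag_mx d *m Q)^T = Q^T *m diag_mx d *m Q.
Proof. by rewrite !trmx_mul trmxK tr_diag_mx mulmxA. Qed.

Lemma exp_spectral n (Q : 'M[R]_n) (d : 'rV[R]_n) m :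
  Q^T *m Q = 1%:M -> Q *m Q^T = 1%:M ->
  (Q^T *m diag_mx d *m Q) ^+ m = Q^T *m diag_mx (map_mx (fun x => x ^+ m) d) *m Q.
Proof.
move=> QQ QQ'; elim: m => [|m IH].
  rewrite expr0 (_ : map_mx _ _ = const_mx 1).
    by rewrite diag_const_mx mulmx1 QQ.
  by apply/matrixP => i j; rewrite !mxE expr0.
rewrite exprS IH -mulmxE mul_spectral //; congr (_ *m diag_mx _ *m _).
by apply/rowP => i; rewrite !mxE exprS.
Qed.

Lemma mxtrace_spectral_mul n (Q : 'M[R]_n) (d : 'rV[R]_n) (Y : 'M[R]_n) :
  \tr (Q^T *m diag_mx d *m Q *m Y) = \sum_i d 0 i * qf Y (col i Q^T).
Proof.
rewrite -!mulmxA mxtrace_mulC; apply: eq_bigr => i _.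
rewrite -mulmxA mul_diag_mx mxE; congr (_ * _).
by rewrite colE /qf trmx_mul trmxK trmx_delta -!mulmxA -rowE !mulmxA -colE !mxE.
Qed.

Definition mexp n (A : 'M[R]_n) := funsym expR A.

Lemma qf_mexp_ge0 n (A : 'M[R]_n) x : A^T = A -> 0 <= qf (mexp A) x.
Proof.
move=> /funsymP[Q [d [_ _ _ E]]]; rewrite /mexp E qf_spectral.
by apply: sumr_ge0 => i _; rewrite mulr_ge0 ?sqr_ge0 // mxE expR_ge0.
Qed.

(** In an eigenbasis q_i of [A] the trace is the sum of exp (d_i) times the form at q_i, hence
    monotone in the form. *)
Lemma mxtrace_mexp_le n (A X Y : 'M[R]_n) : A^T = A ->
  (forall x, qf X x <= qf Y x) -> \tr (mexp A *m X) <= \tr (mexp A *m Y).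
Proof.
move=> /funsymP[Q [d [_ _ _ E]]] XY; rewrite /mexp E !mxtrace_spectral_mul.
by apply: ler_sum => i _; rewrite ler_wpM2l // mxE expR_ge0.
Qed.

(** Both signs of [t] start from exp t <= 1 + t exp t, which is 1 - t <= exp (- t). *)
Lemma expR_le_quadratic (t s : R) : 0 <= s -> t <= s ->
  expR t <= 1 + t + expR s * t ^+ 2.
Proof.
move=> s0 ts.
have e1 : 1 <= expR s by rewrite -expR0 ler_expR.
have e2 : expR t <= expR s by rewrite ler_expR.
have e3 : expR t * (1 - t) <= 1.
  rewrite -[leRHS](expRxMexpNx_1 t) ler_wpM2l ?expR_ge0 //.
  by have := expR_ge1Dx (- t).
have e4 := expR_ge1Dx t; have e5 := expR_ge0 t.
have [t0|t0] := leP 0 t.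
  have : t * (expR t - 1) <= t * (t * expR s).
    rewrite ler_wpM2l //; apply: (@le_trans _ _ (t * expR t)); first by lra.
    by rewrite ler_wpM2l.
  by nra.
have : 0 <= - t * (expR t - 1 - t) by apply: mulr_ge0; lra.
have : 0 <= t * t by nra.
nra.
Qed.

Lemma qf_mexp_le_quadratic n (A : 'M[R]_n) (s : R) x : A^T = A -> 0 <= s ->
  (forall y, qf A y <= s * sqn y) ->
  qf (mexp A) x <= sqn x + qf A x + expR s * sqn (A *m x).
Proof.
move=> symA s0 As.
have [Q [d [QQ QQ' AE E]]] := funsymP symA.
have ds i : d 0 i <= s.
  have := As (Q^T *m delta_mx i 0).
  have Q1 : Q *m (Q^T *m delta_mx i 0) = delta_mx i 0 :> 'cV_n by rewrite mulmxA QQ' mul1mx.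
  rewrite -(sqn_orthogonal _ QQ) {1}AE qf_spectral Q1.
  rewrite (bigD1 i) //= big1 => [|j ji]; last by rewrite !mxE (negPf ji) expr0n mulr0.
  rewrite /sqn (bigD1 i) //= big1 => [|j ji]; last by rewrite !mxE (negPf ji) expr0n.
  by rewrite !mxE !eqxx expr1n !mulr1 !addr0 mulr1.
rewrite /mexp E -(sqn_orthogonal x QQ) -(sqn_orthogonal (A *m x) QQ).
have -> : Q *m (A *m x) = diag_mx d *m (Q *m x).
  by rewrite {1}AE !mulmxA QQ' mul1mx.
rewrite [in qf A x]AE !qf_spectral /sqn mulr_sumr -!big_split /=.
apply: ler_sum => i _; rewrite mul_diag_mx !mxE.
have := expR_le_quadratic s0 (ds i).
have := sqr_ge0 (\sum_j Q i j * x j 0).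
set y := \sum_j _; set dd := d 0 i => y2 h.
have : expR dd * y ^+ 2 <= (1 + dd + expR s * dd ^+ 2) * y ^+ 2 by rewrite ler_wpM2r.
by move/le_trans; apply; rewrite le_eqVlt; apply/orP; left; apply/eqP; ring.
Qed.

(** Some eigenvalue is at least [l], and its exponential alone is counted in the trace. This is how
    a deviation in a single direction becomes visible to the potential. *)
Lemma mxtrace_mexp_ge n (A : 'M[R]_n) (l : R) v : A^T = A -> v != 0 ->
  l * sqn v <= qf A v -> expR l <= \tr (mexp A).
Proof.
move=> symA v0 lv.
have [Q [d [QQ QQ' AE E]]] := funsymP symA.
have [i li] : exists i, l <= d 0 i.
  apply: contrapT => /forallNP h.
  have : qf A v < l * sqn v; last by rewrite ltNge lv.
  rewrite {1}AE qf_spectral -(sqn_orthogonal v QQ) /sqn mulr_sumr.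
  have : Q *m v != 0 by rewrite -sqn_eq0 (sqn_orthogonal _ QQ) sqn_eq0.
  rewrite -sqn_eq0 /sqn => /eqP /psumr_neq0P.
  move=> /(_ (fun i _ => sqr_ge0 _)) [i /andP[_ i0]].
  rewrite (bigD1 i) //= [ltRHS](bigD1 i) //=; apply: ltr_leD.
    by rewrite ltr_pM2r // ltNge; apply/negP; exact: h.
  apply: ler_sum => j _; rewrite ler_wpM2r ?sqr_ge0 // ltW // ltNge.
  by apply/negP; exact: h.
rewrite /mexp E mxtrace_mulC mulmxA QQ' mul1mx mxtrace_diag (bigD1 i) //= mxE.
apply: (@le_trans _ _ (expR (d 0 i))); first by rewrite ler_expR.
by rewrite lerDl; apply: sumr_ge0 => j _; rewrite mxE expR_ge0.
Qed.

Lemma mxtrace_mexp_ge0 n (A : 'M[R]_n) : A^T = A -> 0 <= \tr (mexp A).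
Proof.
move=> /funsymP[Q [d [_ QQ' _ E]]].
rewrite /mexp E mxtrace_mulC mulmxA QQ' mul1mx mxtrace_diag.
by apply: sumr_ge0 => i _; rewrite mxE expR_ge0.
Qed.

Lemma mxtrace_mexp0 n : \tr (mexp (0 : 'M[R]_n)) <= n%:R.
Proof.
have s0 : (0 : 'M[R]_n)^T = 0 by rewrite trmx0.
have -> : n%:R = \sum_(i < n) 1 :> R by rewrite sumr_const card_ord.
rewrite /mxtrace; apply: ler_sum => i _.
have -> : mexp 0 i i = qf (mexp (0 : 'M[R]_n)) (delta_mx i 0).
  by rewrite /qf trmx_delta -rowE -colE !mxE.
apply: (le_trans (@qf_mexp_le_quadratic _ _ 0 _ s0 _ _)) => //.
  by move=> y; rewrite qf0 mul0r.
rewrite qf0 mul0mx addr0 /sqn [X in _ * X]big1 ?mulr0 ?addr0.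
  rewrite (bigD1 i) //= big1 => [|j ji]; last by rewrite !mxE (negPf ji) expr0n.
  by rewrite !mxE !eqxx expr1n addr0.
by move=> j _; rewrite mxE expr0n.
Qed.

End FunctionalCalculus.

(** * The Golden-Thompson inequality *)

Section GoldenThompson.
Context {R : realType}.
Local Open Scope classical_set_scope.

Lemma mxtrace_exp_mulC n (A B : 'M[R]_n) m : \tr ((A * B) ^+ m) = \tr ((B * A) ^+ m).
Proof.
case: m => [|m]; first by rewrite !expr0.
have E j : (A * B) ^+ j * A = A * (B * A) ^+ j.
  elim: j => [|j IH]; first by rewrite !expr0 mul1r mulr1.
  by rewrite exprSr -mulrA -(mulrA A B A) mulrA IH -mulrA -exprSr.
by rewrite exprSr mulrA E -mulrA -mulmxE mxtrace_mulC mulmxE -mulrA -exprSr.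
Qed.

Lemma trmxX n (A : 'M[R]_n) m : (A ^+ m)^T = A^T ^+ m.
Proof.
elim: m => [|m IH]; first by rewrite !expr0 trmx1.
by rewrite exprS exprSr -mulmxE trmx_mul IH.
Qed.

Lemma mxtrace_gram_ge0 m n (A : 'M[R]_(m, n)) : 0 <= \tr (A *m A^T).
Proof.
apply: sumr_ge0 => i _; rewrite mxE; apply: sumr_ge0 => j _.
by rewrite mxE -expr2 sqr_ge0.
Qed.

Lemma mxtrace_mul_le n (A B : 'M[R]_n) :
  2 * \tr (A *m B^T) <= \tr (A *m A^T) + \tr (B *m B^T).
Proof.
have := mxtrace_gram_ge0 (A - B).
rewrite linearB /= mulmxBl !mulmxBr !raddfB /=.
have -> : \tr (B *m A^T) = \tr (A *m B^T) by rewrite -mxtrace_tr trmx_mul trmxK.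
by lra.
Qed.

(* The two inequalities feed each other: squaring reduces the exponent of a
   product to the Gram matrix case and conversely. *)
Lemma mxtrace_exp2n_gram_mul n m :
  (forall M : 'M[R]_n, \tr (M ^+ (2 ^ m.+1)) <= \tr ((M * M^T) ^+ (2 ^ m))) /\
  (forall X Y : 'M[R]_n, X^T = X -> Y^T = Y ->
    \tr ((X * Y) ^+ (2 ^ m)) <= \tr (X ^+ (2 ^ m) * Y ^+ (2 ^ m))).
Proof.
elim: m => [|m [IH1 IH2]].
  split=> [M|X Y _ _]; last by rewrite expn0 !expr1.
  rewrite expn0 expn1 expr1 expr2 -mulmxE.
  by have := mxtrace_mul_le M M^T; rewrite trmxK (mxtrace_mulC M^T); lra.
have sqrX (A : 'M[R]_n) : A ^+ (2 ^ m.+1) = (A * A) ^+ (2 ^ m).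
  by rewrite expnS exprM expr2.
split=> [M|X Y sX sY].
  rewrite expnS exprM expr2; apply: (le_trans (IH1 _)).
  (* Cyclic rotation regroups the Gram matrix of M^2 as a product of the symmetric matrices M^T M
     and M M^T, to which the second inequality applies. *)
  have -> : \tr ((M * M * (M * M)^T) ^+ (2 ^ m)) = \tr (((M^T * M) * (M * M^T)) ^+ (2 ^ m)).
    rewrite -!mulmxE trmx_mul !mulmxE -!mulrA mxtrace_exp_mulC.
    by rewrite -!mulrA mxtrace_exp_mulC -!mulrA mxtrace_exp_mulC -!mulrA mxtrace_exp_mulC -!mulrA.
  set F := M^T * M; set G := M * M^T.
  have sF : F^T = F by rewrite /F -mulmxE trmx_mul trmxK.
  have sG : G^T = G by rewrite /G -mulmxE trmx_mul trmxK.
  apply: (le_trans (IH2 _ _ sF sG)).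
  have := mxtrace_mul_le (F ^+ (2 ^ m)) (G ^+ (2 ^ m)).
  rewrite !trmxX sF sG !mulmxE -!expr2 -!exprM -!expnSr.
  have -> : \tr (F ^+ (2 ^ m.+1)) = \tr (G ^+ (2 ^ m.+1)) by rewrite mxtrace_exp_mulC.
  by lra.
apply: (le_trans (IH1 _)).
rewrite -mulmxE trmx_mul sX sY !mulmxE mulrA -(mulrA X) mxtrace_exp_mulC mulrA.
rewrite !sqrX; apply: IH2.
  by rewrite -mulmxE trmx_mul sX.
by rewrite -mulmxE trmx_mul sY.
Qed.

Definition l1norm n (x : 'cV[R]_n) : R := \sum_i `|x i 0|.
(** Operator bounds in the l1 norm are submultiplicative and finite by an explicit sum of entries;
    they control the error in the Lie product formula. *)
Definition opbound n (A : 'M[R]_n) (a : R) := forall x, l1norm (A *m x) <= a * l1norm x.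

Lemma l1norm_ge0 n (x : 'cV[R]_n) : 0 <= l1norm x.
Proof. by apply: sumr_ge0. Qed.

Lemma l1normD n (x y : 'cV[R]_n) : l1norm (x + y) <= l1norm x + l1norm y.
Proof. by rewrite /l1norm -big_split /=; apply: ler_sum => i _; rewrite mxE ler_normD. Qed.

Lemma opboundD n (A B : 'M[R]_n) a b :
  opbound A a -> opbound B b -> opbound (A + B) (a + b).
Proof. by move=> hA hB x; rewrite mulmxDl (le_trans (l1normD _ _)) // mulrDl lerD. Qed.

Lemma opboundM n (A B : 'M[R]_n) a b : 0 <= a ->
  opbound A a -> opbound B b -> opbound (A *m B) (a * b).
Proof.
by move=> a0 hA hB x; rewrite -mulmxA (le_trans (hA _)) // -mulrA ler_wpM2l.
Qed.

Lemma opboundZ n (A : 'M[R]_n) a c : opbound A a -> opbound (c *: A) (`|c| * a).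
Proof.
move=> hA x; rewrite -scalemxAl -mulrA.
have -> : l1norm (c *: (A *m x)) = `|c| * l1norm (A *m x).
  by rewrite /l1norm mulr_sumr; apply: eq_bigr => i _; rewrite mxE normrM.
by rewrite ler_wpM2l.
Qed.

Lemma opbound1 n : opbound (1%:M : 'M[R]_n) 1.
Proof. by move=> x; rewrite mul1mx mul1r. Qed.

Lemma opbound_le n (A : 'M[R]_n) a b : a <= b -> opbound A a -> opbound A b.
Proof. by move=> ab hA x; rewrite (le_trans (hA _)) // ler_wpM2r ?l1norm_ge0. Qed.

Lemma opboundX n (A : 'M[R]_n) a m : 0 <= a -> opbound A a -> opbound (A ^+ m) (a ^+ m).
Proof.
move=> a0 hA; elim: m => [|m IH]; first by rewrite !expr0; exact: opbound1.
by rewrite !exprS -mulmxE; exact: opboundM.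
Qed.

Lemma opbound_exists n (A : 'M[R]_n) : exists2 a, 0 <= a & opbound A a.
Proof.
exists (\sum_i \sum_j `|A i j|).
  by apply: sumr_ge0 => i _; apply: sumr_ge0.
move=> x; rewrite /l1norm mulr_suml; apply: ler_sum => i _.
rewrite mxE (le_trans (ler_norm_sum _ _ _)) // mulr_suml.
apply: ler_sum => j _; rewrite normrM ler_wpM2l //.
by rewrite (bigD1 j) //= lerDl; apply: sumr_ge0.
Qed.

Lemma opbound_mxtrace n (A : 'M[R]_n) a : opbound A a -> \tr A <= n%:R * a.
Proof.
move=> hA; rewrite mulr_natl -[n in X in _ <= X]card_ord -sumr_const.
apply: ler_sum => i _.
have := hA (delta_mx i 0).
have -> : l1norm (delta_mx i 0 : 'cV[R]_n) = 1.
  rewrite /l1norm (bigD1 i) //= big1 => [|j ji]; first by rewrite !mxE !eqxx normr1 addr0.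
  by rewrite !mxE (negPf ji) normr0.
rewrite mulr1; apply: le_trans.
rewrite -colE /l1norm (bigD1 i) //= mxE (le_trans (ler_norm _)) // lerDl.
by apply: sumr_ge0.
Qed.

(** Telescoping: the factors [Y] are replaced by [X] one at a time, each replacement costing [e]. *)
Lemma opbound_subX n (X Y : 'M[R]_n) K e m : 1 <= K -> 0 <= e ->
  opbound X K -> opbound Y K -> opbound (X - Y) e ->
  opbound (X ^+ m - Y ^+ m) (m%:R * e * K ^+ m).
Proof.
move=> K1 e0 hX hY hXY; have K0 : 0 <= K by rewrite (le_trans ler01).
elim: m => [|m IH].
  by rewrite !expr0 subrr !mul0r => x; rewrite mul0mx mul0r /l1norm big1 // => i _; rewrite mxE normr0.
have -> : X ^+ m.+1 - Y ^+ m.+1 = X *m (X ^+ m - Y ^+ m) + (X - Y) *m Y ^+ m.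
  by rewrite mulmxBr mulmxBl !mulmxE !exprS addrA subrK.
have h := opboundD (opboundM K0 hX IH) (opboundM e0 hXY (opboundX m K0 hY)).
apply: opbound_le h.
rewrite -natr1 exprS.
have : e * K ^+ m <= e * (K * K ^+ m) by rewrite ler_wpM2l // ler_peMl // exprn_ge0.
by nra.
Qed.

Lemma cvg_sumr (I : finType) (F : I -> nat -> R) (l : I -> R) :
  (forall i, F i m @[m --> \oo] --> l i) ->
  (\sum_i F i m) @[m --> \oo] --> \sum_i l i.
Proof.
move=> h; elim: (index_enum I) => [|i s IH].
  rewrite big_nil (_ : (fun m => _) = fun=> 0); first exact: cvg_cst.
  by apply/funext => m; rewrite big_nil.
rewrite big_cons (_ : (fun m => _) = fun m => F i m + \sum_(j <- s) F j m).
  exact: cvgD.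
by apply/funext => m; rewrite big_cons.
Qed.

Lemma cvg_half_exp : (2 ^- m : R) @[m --> \oo] --> (0 : R).
Proof.
have h : @geometric R 1 2^-1 @ \oo --> (0 : R).
  by apply: cvg_geometric; rewrite ger0_norm; lra.
rewrite (_ : (fun m => 2 ^- m) = @geometric R 1 2^-1) //.
by apply/funext => m; rewrite /= mul1r exprVn.
Qed.

Lemma expR_le_1D (t : R) : - 2^-1 <= t -> expR (t - 2 * t ^+ 2) <= 1 + t.
Proof.
move=> t0; have t1 : 0 < 1 + t by lra.
have ts : t - 2 * t ^+ 2 <= t / (1 + t).
  by rewrite ler_pdivlMr //; nra.
apply: (@le_trans _ _ (expR (t / (1 + t)))); first by rewrite ler_expR.
rewrite -[expR _]invrK -expRN -[leRHS]invrK lef_pV2 ?posrE ?invr_gt0 ?expR_gt0 //.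
apply: le_trans (expR_ge1Dx _).
rewrite le_eqVlt; apply/orP; left; apply/eqP; field.
by rewrite gt_eqF.
Qed.

(** Squeezed between exp (x - 2 x^2 / 2^m) and exp x. Euler's limit is taken along powers of two to
    match the exponents in [mxtrace_exp2n_gram_mul]. *)
Lemma cvg_exp_half (x : R) : ((1 + 2 ^- m * x) ^+ (2 ^ m)) @[m --> \oo] --> expR x.
Proof.
have h1 : (expR (x - 2 * x ^+ 2 * 2 ^- m)) @[m --> \oo] --> expR x.
  have h0 : (x - 2 * x ^+ 2 * 2 ^- m) @[m --> \oo] --> x.
    suff : (x - 2 * x ^+ 2 * 2 ^- m) @[m --> \oo] --> x - 2 * x ^+ 2 * 0.
      by rewrite mulr0 subr0.
    apply: (@cvgB _ _ _ _ _ (fun=> x) (fun m => 2 * x ^+ 2 * 2 ^- m)); first exact: cvg_cst.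
    by apply: cvgMl_tmp; exact: cvg_half_exp.
  by apply: continuous_cvg => //; exact: continuous_expR.
have h2 : (expR x) @[m --> \oo] --> expR x by exact: cvg_cst.
apply: (squeeze_cvgr _ h1 h2).
have : \forall m \near \oo, 2 ^- m * x > - 2^-1.
  have : (2 ^- m * x) @[m --> \oo] --> (0 : R).
    suff : (2 ^- m * x) @[m --> \oo] --> 0 * x by rewrite mul0r.
    by apply: cvgMr_tmp; exact: cvg_half_exp.
  move/cvgr_gt; apply; lra.
apply: filterS => m t0.
have nE : (2 ^ m)%:R * (2 ^- m * x) = x.
  by rewrite natrX mulrA divff ?mul1r // expf_neq0.
have t1 : 0 <= 1 + 2 ^- m * x by lra.
apply/andP; split.
  have -> : x - 2 * x ^+ 2 * 2 ^- m = (2 ^ m)%:R * (2 ^- m * x - 2 * (2 ^- m * x) ^+ 2).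
    rewrite mulrBr nE; congr (_ - _).
    set h := 2 ^- m; set N := (2 ^ m)%:R; rewrite -/h -/N in nE.
    have -> : N * (2 * (h * x) ^+ 2) = 2 * (N * (h * x)) * (h * x) by ring.
    by rewrite nE; ring.
  rewrite expRM_natl lerXn2r ?nnegrE ?expR_ge0 //.
  by apply: expR_le_1D; exact: ltW.
have {2}-> : x = (2 ^ m)%:R * (2 ^- m * x) by rewrite nE.
by rewrite expRM_natl lerXn2r ?nnegrE ?expR_ge0 // expR_ge1Dx.
Qed.

Lemma cvg_mexp n (A : 'M[R]_n) i j : A^T = A ->
  (((1%:M + 2 ^- m *: A) ^+ (2 ^ m)) i j : R) @[m --> \oo] --> mexp A i j.
Proof.
move=> /funsymP[Q [d [QQ QQ' AE E]]]; rewrite /mexp E entry_spectral.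
have -> : (fun m => ((1%:M + 2 ^- m *: A) ^+ (2 ^ m)) i j) =
    (fun m => \sum_l (1 + 2 ^- m * d 0 l) ^+ (2 ^ m) * (Q l i * Q l j)).
  apply/funext => m.
  have -> : 1%:M + 2 ^- m *: A = Q^T *m diag_mx (\row_l (1 + 2 ^- m * d 0 l)) *m Q.
    rewrite {1}AE -{1}QQ -{1}[Q^T]mulmx1 scalemxAl scalemxAr -mulmxDl -mulmxDr.
    congr (_ *m _ *m _); apply/matrixP => a b; rewrite !mxE.
    by case: eqVneq => _; rewrite ?mulr1n ?mulr0n ?mulr0 ?addr0.
  by rewrite exp_spectral // entry_spectral; apply: eq_bigr => l _; rewrite !mxE.
apply: (@cvg_sumr _ (fun l m => (1 + 2 ^- m * d 0 l) ^+ (2 ^ m) * (Q l i * Q l j))) => l.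
by rewrite mxE; apply: cvgMr_tmp; exact: cvg_exp_half.
Qed.

(** Lie product formula: 1 + h (A + B) and (1 + h A) (1 + h B) differ by h^2 A B, so their powers
    with exponent 1 / h = 2^m differ by O(h). The trace inequality splits the second power into
    powers of its factors, and m tends to infinity. *)
Theorem golden_thompson n (A B : 'M[R]_n) : A^T = A -> B^T = B ->
  \tr (mexp (A + B)) <= \tr (mexp A *m mexp B).
Proof.
move=> sA sB.
have sAB : (A + B)^T = A + B by rewrite linearD /= sA sB.
have [a a0 hA] := opbound_exists A.
have [b b0 hB] := opbound_exists B.
pose C := n%:R * (a * b * expR (a + b)).
pose E (M : 'M[R]_n) m := (1%:M + 2 ^- m *: M) ^+ (2 ^ m).
have cvgL : \tr (E (A + B) m) @[m --> \oo] --> \tr (mexp (A + B)).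
  by apply: (@cvg_sumr _ (fun i m => E (A + B) m i i)) => i; exact: cvg_mexp.
have cvgR : (\tr (E A m *m E B m) + 2 ^- m * C) @[m --> \oo] --> \tr (mexp A *m mexp B).
  rewrite -[\tr (mexp A *m _)]addr0 -(mul0r C); apply: cvgD; last first.
    by apply: cvgMr_tmp; exact: cvg_half_exp.
  rewrite (_ : (fun m => \tr (E A m *m E B m)) =
     fun m => \sum_i \sum_j E A m i j * E B m j i); last first.
    by apply/funext => m; apply: eq_bigr => i _; rewrite mxE.
  rewrite (_ : \tr (mexp A *m mexp B) = \sum_i \sum_j mexp A i j * mexp B j i); last first.
    by apply: eq_bigr => i _; rewrite mxE.
  apply: (@cvg_sumr _ (fun i m => \sum_j E A m i j * E B m j i)) => i.
  apply: (@cvg_sumr _ (fun j m => E A m i j * E B m j i)) => j.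
  by apply: cvgM; exact: cvg_mexp.
apply: ler_cvg_to cvgL cvgR _; near=> m.
set h : R := 2 ^- m.
have h0 : 0 < h by rewrite /h invr_gt0 exprn_gt0.
have nh : (2 ^ m)%:R * h = 1 :> R by rewrite /h natrX divff // expf_neq0.
pose X := (1%:M + h *: A) *m (1%:M + h *: B).
pose Y := 1%:M + h *: (A + B).
have XY : X - Y = (h ^+ 2) *: (A *m B).
  rewrite /X /Y mulmxDl mul1mx mulmxDr mulmx1 -scalemxAl -scalemxAr scalerA -expr2.
  by rewrite scalerDr opprD addrACA; apply/matrixP => i j; rewrite !mxE; ring.
have sh M : M^T = M -> (1%:M + h *: M)^T = 1%:M + h *: M :> 'M[R]_n.
  by move=> sM; rewrite linearD /= trmxZ trmx1 sM.
have K1 : 1 <= expR (h * (a + b)) by rewrite -expR0 ler_expR; apply: mulr_ge0; [exact: ltW | exact: addr_ge0].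
have bh (M : 'M[R]_n) c : opbound M c -> opbound (1%:M + h *: M) (1 + h * c).
  by move=> hM; rewrite -{2}(ger0_norm (ltW h0)); apply: opboundD; [exact: opbound1|exact: opboundZ].
have bX : opbound X (expR (h * (a + b))).
  have ha0 : 0 <= 1 + h * a by apply: addr_ge0 => //; apply: mulr_ge0 => //; exact: ltW.
  have hb0 : 0 <= 1 + h * b by apply: addr_ge0 => //; apply: mulr_ge0 => //; exact: ltW.
  apply: opbound_le (opboundM ha0 (bh _ _ hA) (bh _ _ hB)).
  by rewrite (mulrDr h) expRD ler_pM // expR_ge1Dx.
have bY : opbound Y (expR (h * (a + b))).
  by apply: opbound_le (bh _ _ (opboundD hA hB)); exact: expR_ge1Dx.
have bXY : opbound (X - Y) (h ^+ 2 * (a * b)).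
  have := opboundZ (h ^+ 2) (opboundM a0 hA hB).
  by rewrite XY ger0_norm ?sqr_ge0.
have e0 : 0 <= h ^+ 2 * (a * b) by rewrite !mulr_ge0 // ltW.
have bYX : opbound (Y - X) (h ^+ 2 * (a * b)).
  by have := opboundZ (-1) bXY; rewrite normrN1 mul1r scaleN1r opprB.
have := opbound_mxtrace (opbound_subX (2 ^ m) K1 e0 bY bX bYX).
rewrite -expRM_natl mulrA nh mul1r raddfB /=.
have -> : (2 ^ m)%:R * (h ^+ 2 * (a * b)) = h * (a * b).
  by rewrite expr2 !mulrA nh mul1r.
rewrite lerBlDr => le1.
have [_ GT] := mxtrace_exp2n_gram_mul n m.
have le2 := GT _ _ (sh _ sA) (sh _ sB).
rewrite /E -/h; apply: (le_trans le1).
rewrite addrC; apply: lerD; first exact: le2.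
by rewrite /C le_eqVlt; apply/orP; left; apply/eqP; ring.
Unshelve. all: by end_near.
Qed.

End GoldenThompson.

(** * Exponential moments of Rademacher sums *)

Section ScalarBounds.
Context {R : realType}.

(** exp (1/8) <= 1 / (1 - 1/8) = 8/7, and (8/7)^8 < 3. *)
Lemma expR1_le3 : expR 1 <= 3 :> R.
Proof.
have h : expR (8^-1) <= 8 / 7 :> R.
  have := expRxMexpNx_1 (8^-1 : R); have := expR_ge1Dx (- 8^-1 : R).
  by have := expR_gt0 (8^-1 : R); nra.
have -> : expR 1 = expR (8^-1) ^+ 8 :> R.
  by rewrite -expRM_natl; congr expR; lra.
apply: (@le_trans _ _ ((8 / 7) ^+ 8)); last by lra.
by rewrite lerXn2r ?nnegrE ?expR_ge0 //; lra.
Qed.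

(** For |t| <= 1 the linear terms of the two quadratic bounds cancel; beyond, |t| <= 3 t^2
    already. *)
Lemma cosh_le (t : R) : expR t + expR (- t) <= 2 * expR (3 * t ^+ 2).
Proof.
have [t1|t1] := leP `|t| 1.
  have /andP[ta tb] : -1 <= t <= 1 by rewrite -ler_norml.
  have h1 := expR_le_quadratic ler01 tb.
  have h2 : expR (- t) <= 1 + - t + expR 1 * (- t) ^+ 2 by apply: expR_le_quadratic; lra.
  have := expR_ge1Dx (3 * t ^+ 2); have := expR1_le3.
  have := sqr_ge0 t; rewrite sqrrN in h2; nra.
have h (s : R) : s <= `|t| -> expR s <= expR (3 * t ^+ 2).
  by move=> st; rewrite ler_expR (le_trans st) // -real_normK ?num_real //; nra.
by have := h t (ler_norm t); have := h (- t); rewrite -normrN ler_norm => /(_ isT); lra.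
Qed.

Lemma expR_le_1D4x (x : R) : 0 <= x <= 1 -> expR x <= 1 + 4 * x.
Proof.
move=> /andP[x0 x1]; have := expR_le_quadratic ler01 x1; have := expR1_le3.
have : x ^+ 2 <= x by rewrite expr2 ler_piMr.
have := sqr_ge0 x; nra.
Qed.

End ScalarBounds.

(** * Quadratic forms of inverse matrices *)

Section InverseForms.
Context {R : realType}.
Variables (n : nat) (M : 'M[R]_n) (b : R).
Hypotheses (symM : M^T = M) (b0 : 0 < b) (Mb : forall y, b * sqn y <= qf M y).

Lemma coercive_unit : M \in unitmx.
Proof.
rewrite -row_free_unit -kermx_eq0; apply/eqP/row_matrixP => i.
rewrite row0; apply: trmx_inj; rewrite trmx0; apply/eqP; rewrite -sqn_eq0.
have : row i (kermx M) *m M = 0 by rewrite -row_mul mulmx_ker row0.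
set v := row i _ => vM; have := Mb v^T.
rewrite /qf trmxK vM mul0mx mxE; have := sqn_ge0 v^T => ? ?.
by rewrite eq_le; apply/andP; split=> //; rewrite -(pmulr_rle0 _ b0).
Qed.

Lemma inner_sym (x y : 'cV[R]_n) : inner x (M *m y) = inner (M *m x) y.
Proof. by rewrite /inner trmx_mul symM mulmxA. Qed.

Lemma innerD (x y z : 'cV[R]_n) : inner (x + y) z = inner x z + inner y z.
Proof. by rewrite !innerE -big_split; apply: eq_bigr => i _; rewrite mxE mulrDl. Qed.

Lemma innerZ a (x y : 'cV[R]_n) : inner (a *: x) y = a * inner x y.
Proof. by rewrite !innerE mulr_sumr; apply: eq_bigr => i _; rewrite mxE mulrA. Qed.

Lemma qf_inner (A : 'M[R]_n) x : qf A x = inner x (A *m x).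
Proof. by rewrite /qf /inner mulmxA. Qed.

Lemma qf_lin (a c : R) x y :
  qf M (a *: x + c *: y) = a ^+ 2 * qf M x + 2 * a * c * inner x (M *m y) + c ^+ 2 * qf M y.
Proof.
rewrite !qf_inner mulmxDr -!scalemxAr innerD !innerZ.
rewrite ![inner _ (_ + _)]innerC !innerD !innerZ ![inner (M *m _) _]innerC.
have -> : inner y (M *m x) = inner x (M *m y) by rewrite inner_sym innerC.
by ring.
Qed.

Lemma qf_invmx x : qf (invmx M) x = qf M (invmx M *m x).
Proof.
by rewrite !qf_inner mulmxA mulmxV ?coercive_unit // mul1mx innerC.
Qed.

Lemma qf_invmx_le x : qf (invmx M) x <= b^-1 * sqn x.
Proof.
have := Mb (invmx M *m x); rewrite -qf_invmx.
set y := invmx M *m x; have qE : qf (invmx M) x = inner x y by rewrite qf_inner.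
have : 0 <= sqn (b *: y - x) by exact: sqn_ge0.
have -> : sqn (b *: y - x) = b ^+ 2 * sqn y - 2 * b * inner x y + sqn x.
  rewrite /sqn innerE !mulr_sumr -sumrB -big_split; apply: eq_bigr => i _.
  by rewrite !mxE /=; ring.
rewrite qE => h1 h2; rewrite mulrC ler_pdivlMr //.
have : b * (b * sqn y) <= b * inner x y by rewrite ler_wpM2l // ltW.
by lra.
Qed.

(** Variational formula for M^-1, with equality at y = M^-1 x: the gap between the two sides is the
    form of [M] at M^-1 x - y. *)
Lemma qf_invmx_ge x y : 2 * inner x y - qf M y <= qf (invmx M) x.
Proof.
have : 0 <= qf M (1 *: (invmx M *m x) + (-1) *: y).
  by apply: le_trans (Mb _); rewrite mulr_ge0 ?sqn_ge0 // ltW.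
rewrite qf_lin -qf_invmx inner_sym mulmxA mulmxV ?coercive_unit // mul1mx.
by nra.
Qed.

End InverseForms.

Section Rademacher.
Context {R : realType}.
Variables (I : finType) (k : nat) (u : I -> 'cV[R]_k).

Definition rsum (l : seq I) (e : {ffun I -> bool}) : 'cV[R]_k :=
  \sum_(i <- l) (-1) ^+ e i *: u i.

Definition cov (l : seq I) : 'M[R]_k := \sum_(i <- l) u i *m (u i)^T.

(** Expectations over signs are kept as sums over all sign vectors; this is their normalisation. *)
Definition nsigns : R := #|{ffun I -> bool}|%:R.

Lemma nsigns_gt0 : 0 < nsigns.
Proof. by rewrite ltr0n; apply/card_gt0P; exists [ffun=> true]. Qed.

Lemma sum_nsigns c : \sum_(e : {ffun I -> bool}) c = nsigns * c.
Proof. by rewrite sumr_const mulr_natl. Qed.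

Lemma qf_cov l x : qf (cov l) x = \sum_(i <- l) inner (u i) x ^+ 2.
Proof. by rewrite qf_sum; apply: eq_bigr => i _; rewrite qf_outer. Qed.

Lemma cov_sym l : (cov l)^T = cov l.
Proof.
by rewrite /cov raddf_sum; apply: eq_bigr => i _; rewrite /= trmx_mul trmxK.
Qed.

Definition flip (j : I) (e : {ffun I -> bool}) : {ffun I -> bool} :=
  [ffun i => (i == j) (+) e i].

Lemma flipK j : involutive (flip j).
Proof. by move=> e; apply/ffunP => i; rewrite !ffunE addbA addbb. Qed.

(** Every sign vector is paired with the one flipped at [j]. *)
Lemma rsum_cons (F : 'cV[R]_k -> R) j l : j \notin l ->
  2 * \sum_e F (rsum (j :: l) e) = \sum_e (F (rsum l e + u j) + F (rsum l e - u j)).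
Proof.
move=> jl.
have E : \sum_e F (rsum (j :: l) e) = \sum_e F (rsum l e - (-1) ^+ e j *: u j).
  rewrite (reindex_inj (inv_inj (flipK j))); apply: eq_bigr => e _.
  rewrite /rsum big_cons addrC !ffunE eqxx addTb signrN scaleNr; congr (F (_ - _)).
  rewrite !big_seq; apply: eq_bigr => i il; rewrite ffunE.
  by case: eqVneq il => [->|_ _]; [rewrite (negPf jl) | rewrite addFb].
rewrite mulr2n mulrDl !mul1r {1}E -big_split; apply: eq_bigr => e _ /=.
rewrite /rsum big_cons; case: (e j); rewrite ?expr1 ?expr0 ?scaleN1r ?scale1r ?opprK addrC //.
  by rewrite [in LHS]addrC [- _ + _]addrC addrC.
by rewrite [u j + _]addrC.
Qed.

Lemma rsum_nil e : rsum [::] e = 0.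
Proof. by rewrite /rsum big_nil. Qed.

Lemma sqr_moment l x : uniq l ->
  \sum_e inner (rsum l e) x ^+ 2 = nsigns * \sum_(i <- l) inner (u i) x ^+ 2.
Proof.
elim: l => [_|j l IH /= /andP[jl ul]].
  rewrite big_nil mulr0 big1 // => e _; rewrite rsum_nil innerE big1 ?expr0n // => i _.
  by rewrite mxE mul0r.
rewrite big_cons mulrDr -IH // -sum_nsigns -big_split /=.
have := rsum_cons (fun z => inner z x ^+ 2) jl => /= h.
apply: (mulfI (_ : 2 != 0)) => //; rewrite h mulr_sumr; apply: eq_bigr => e _.
by rewrite -[- u j]scaleN1r !innerD innerZ; ring.
Qed.

(** Adding a vector contributes 6 a^2 s + a^4, with s the second moment, and 3 s^2 + 6 a^2 s + a^4
    <= 3 (s + a^2)^2. *)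
Lemma fourth_moment l x : uniq l ->
  \sum_e inner (rsum l e) x ^+ 4 <= nsigns * (3 * (\sum_(i <- l) inner (u i) x ^+ 2) ^+ 2).
Proof.
elim: l => [_|j l IH /= /andP[jl ul]].
  rewrite big_nil expr0n !mulr0 big1 // => e _; rewrite rsum_nil innerE big1 ?expr0n // => i _.
  by rewrite mxE mul0r.
rewrite big_cons; set a := inner (u j) x; set s := \sum_(i <- l) _.
have h := rsum_cons (fun z => inner z x ^+ 4) jl.
have E : \sum_e inner (rsum (j :: l) e) x ^+ 4 =
   \sum_e inner (rsum l e) x ^+ 4 + 6 * a ^+ 2 * \sum_e inner (rsum l e) x ^+ 2
   + nsigns * a ^+ 4.
  apply: (mulfI (_ : 2 != 0)) => //; rewrite h -sum_nsigns mulr_sumr -!big_split mulr_sumr.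
  by apply: eq_bigr => e _; rewrite -[- u j]scaleN1r !innerD innerZ -/a /=; ring.
rewrite E sqr_moment // -/s; have := IH ul; rewrite -/s; have := nsigns_gt0.
have : 0 <= a ^+ 4 by rewrite (exprM a 2 2) sqr_ge0.
by move=> ? ? ?; nra.
Qed.

(* The recursion M' = M - 12 u u^T dominates, by the variational formula for
   M^-1, the exponent produced by averaging over one sign. *)
Lemma exp_moment_invmx l (M : 'M[R]_k) b : uniq l -> M^T = M -> 0 < b ->
  (forall y, b * sqn y + 12 * qf (cov l) y <= qf M y) ->
  \sum_e expR (qf (invmx M) (rsum l e)) <= nsigns * expR (b^-1 * \sum_(i <- l) sqn (u i)).
Proof.
elim: l M => [|j l IH] M.
  move=> _ _ _ _; rewrite big_nil mulr0 -sum_nsigns; apply: ler_sum => e _.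
  by rewrite rsum_nil qf_inner innerE big1 // => i _; rewrite mxE mul0r.
move=> /= /andP[jl ul] sM b0 hM.
have hMb y : b * sqn y <= qf M y.
  apply: le_trans (hM y); rewrite lerDl mulr_ge0 //.
  by rewrite qf_cov; apply: sumr_ge0 => i _; exact: sqr_ge0.
pose M' := M - 12 *: (u j *m (u j)^T).
have qM' y : qf M' y = qf M y - 12 * inner (u j) y ^+ 2 by rewrite qfD qfN qfZ qf_outer.
have sM' : M'^T = M' by rewrite linearB /= trmxZ trmx_mul trmxK sM.
have hM' y : b * sqn y + 12 * qf (cov l) y <= qf M' y.
  by have := hM y; rewrite qM' !qf_cov big_cons; lra.
have hMb' y : b * sqn y <= qf M' y.
  apply: le_trans (hM' y); rewrite lerDl mulr_ge0 //.
  by rewrite qf_cov; apply: sumr_ge0 => i _; exact: sqr_ge0.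
have h := rsum_cons (fun z => expR (qf (invmx M) z)) jl.
rewrite -(ler_pM2l (_ : 0 < 2)) // h big_cons mulrDr expRD.
rewrite (mulrCA nsigns) [leRHS]mulrCA.
apply: (@le_trans _ _ (expR (b^-1 * sqn (u j)) * (2 * \sum_e expR (qf (invmx M') (rsum l e))))); last first.
  by rewrite ler_wpM2l ?expR_ge0 // ler_wpM2l //; exact: IH.
have := qf_invmx_le b0 hMb (u j); move: (b^-1 * sqn (u j)) => B1 h1.
rewrite mulrA mulr_sumr; apply: ler_sum => e _; set z := rsum l e.
have sV : (invmx M)^T = invmx M by rewrite trmx_inv sM.
pose t := 2 * inner (u j) (invmx M *m z).
have E (s : R) : qf (invmx M) (z + s *: u j) = qf (invmx M) z + s * t + s ^+ 2 * qf (invmx M) (u j).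
  have := qf_lin sV 1 s z (u j); rewrite scale1r => ->.
  by rewrite inner_sym // [inner (_ *m z) _]innerC /t; ring.
have -> : qf (invmx M) (z + u j) = qf (invmx M) z + qf (invmx M) (u j) + t.
  by have := E 1; rewrite scale1r => ->; ring.
have -> : qf (invmx M) (z - u j) = qf (invmx M) z + qf (invmx M) (u j) - t.
  by have := E (-1); rewrite scaleN1r => ->; ring.
rewrite !(expRD (_ + _)) -mulrDr.
apply: (@le_trans _ _ (expR (qf (invmx M) z + qf (invmx M) (u j)) * (2 * expR (3 * t ^+ 2)))).
  by rewrite ler_wpM2l ?expR_ge0 // cosh_le.
rewrite mulrCA [expR B1 * 2]mulrC -mulrA ler_pM2l // -!expRD ler_expR.
(* Taking y = M^-1 z in the variational formula for M' gains 12 <u_j, M^-1 z>^2 = 3 t^2, exactly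
   what [cosh_le] costs; hence the constant 12. *)
have h2 := qf_invmx_ge sM' b0 hMb' z (invmx M *m z).
move: h2; rewrite qM' -(qf_invmx b0 hMb) -qf_inner => h2.
have -> : 3 * t ^+ 2 = 12 * inner (u j) (invmx M *m z) ^+ 2 by rewrite /t; ring.
by lra.
Qed.

Lemma exp_moment l : uniq l -> (forall y, qf (cov l) y <= sqn y) ->
  \sum_e expR (16^-1 * sqn (rsum l e)) <= nsigns * expR (\sum_(i <- l) sqn (u i)).
Proof.
move=> ul hl.
(* 16 = 4 + 12: the covariance is at most the identity, so the margin b = 4 remains. *)
pose M : 'M[R]_k := 16%:M.
have qM y : qf M y = 16 * sqn y by rewrite /M -scalemx1 qfZ qf1.
have Mi : invmx M = (16^-1)%:M.
  have M1 : (16^-1)%:M *m M = 1%:M by rewrite -scalar_mxM mulVf.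
  have Mu : M \in unitmx by case: (mulmx1_unit M1).
  by rewrite -[LHS]mul1mx -M1 mulmxK.
have := @exp_moment_invmx l M 4 ul (tr_scalar_mx _ _) _ _.
rewrite Mi => h.
under eq_bigr do rewrite -qf1 -qfZ scalemx1.
apply: le_trans (h _ _) _ => //.
  by move=> y; rewrite qM; have := hl y; lra.
rewrite ler_wpM2l ?(ltW nsigns_gt0) // ler_expR.
have : 0 <= \sum_(i <- l) sqn (u i) by apply: sumr_ge0 => i _; exact: sqn_ge0.
lra.
Qed.

Lemma inner_sqr_le (x y : 'cV[R]_k) : inner x y ^+ 2 <= sqn x * sqn y.
Proof.
have [->|x0] := eqVneq x 0.
  by rewrite innerE big1 ?expr0n ?mulr_ge0 ?sqn_ge0 // => i _; rewrite mxE mul0r.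
have := sqn_ge0 (sqn x *: y + (- inner x y) *: x).
rewrite -qf1 (qf_lin (trmx1 _ _)) !qf1 mul1mx (innerC y x).
have : 0 < sqn x by rewrite sqn_gt0.
set X := sqn x; set Y := sqn y; set p := inner x y => X0.
have -> : X ^+ 2 * Y + 2 * X * - p * p + (- p) ^+ 2 * X = X * (X * Y - p ^+ 2) by ring.
by rewrite pmulr_rge0 // subr_ge0.
Qed.

(** The form of cov at x - cov x is nonnegative, and cov <= 1; together these give cov^2 <= cov. *)
Lemma sqn_cov_le l x : (forall y, qf (cov l) y <= sqn y) -> sqn (cov l *m x) <= qf (cov l) x.
Proof.
move=> hl; have := hl (cov l *m x).
have : 0 <= qf (cov l) (1 *: x + (-1) *: (cov l *m x)).
  by rewrite qf_cov; apply: sumr_ge0 => i _; exact: sqr_ge0.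
rewrite qf_lin ?cov_sym // inner_sym ?cov_sym //.
by rewrite -[inner _ _]/((_^T *m _) 0 0) sqnE; lra.
Qed.

(** With a the exponential and b the inner product, a b^2 <= (t a^2 + b^4 / t) / 2, and [exp_moment]
    handles a^2. The weight t = [qf (cov l) x] makes both halves proportional to t. *)
Lemma exp_sqr_moment l x : uniq l -> (forall y, qf (cov l) y <= sqn y) ->
  \sum_e expR (32^-1 * sqn (rsum l e)) * inner (rsum l e) x ^+ 2 <=
  nsigns * (2 * expR (\sum_(i <- l) sqn (u i)) * qf (cov l) x).
Proof.
move=> ul hl; set t := qf (cov l) x; set E := expR (\sum_(i <- l) _).
have E1 : 1 <= E.
  by rewrite /E -expR0 ler_expR; apply: sumr_ge0 => i _; exact: sqn_ge0.
have m2 := sqr_moment x ul; rewrite -qf_cov -/t in m2.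
have : 0 <= t by rewrite /t qf_cov; apply: sumr_ge0 => i _; exact: sqr_ge0.
rewrite le_eqVlt => /orP[/eqP t0|t0].
  (* If t = 0 the second moment vanishes, and with it every inner product. *)
  rewrite -t0 mulr0 in m2; rewrite -t0 !mulr0 big1 // => e _.
  move/eqP: m2; rewrite psumr_eq0 => [/allP|? _]; last exact: sqr_ge0.
  by move=> /(_ e (mem_index_enum _)) /eqP ->; rewrite mulr0.
have m4 := fourth_moment x ul; rewrite -qf_cov -/t in m4.
have me := exp_moment ul hl; rewrite -/E in me.
apply: (@le_trans _ _ (\sum_e (2^-1 * (t * expR (16^-1 * sqn (rsum l e)) + t^-1 * inner (rsum l e) x ^+ 4)))).
  apply: ler_sum => e _.
  have -> : expR (16^-1 * sqn (rsum l e)) = expR (32^-1 * sqn (rsum l e)) ^+ 2.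
    by rewrite -expRM_natl; congr expR; field.
  set a := expR _; set b := inner _ _.
  have : 0 <= t^-1 * (t * a - b ^+ 2) ^+ 2 by rewrite mulr_ge0 ?sqr_ge0 // invr_ge0 ltW.
  have -> : t^-1 * (t * a - b ^+ 2) ^+ 2 = t * a ^+ 2 - 2 * (a * b ^+ 2) + t^-1 * b ^+ 4.
    by field; rewrite gt_eqF.
  by lra.
rewrite -mulr_sumr big_split /= -!mulr_sumr.
have h1 : t * \sum_e expR (16^-1 * sqn (rsum l e)) <= t * (nsigns * E) by rewrite ler_wpM2l // ltW.
have h2 : t^-1 * \sum_e inner (rsum l e) x ^+ 4 <= t^-1 * (nsigns * (3 * t ^+ 2)).
  by rewrite ler_wpM2l // invr_ge0 ltW.
have e2 : t^-1 * (nsigns * (3 * t ^+ 2)) = 3 * (nsigns * t).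
  by field; rewrite gt_eqF.
have : nsigns * t <= nsigns * t * E by rewrite ler_peMr // mulr_ge0 ?(ltW nsigns_gt0) // ltW.
by rewrite e2 in h2; lra.
Qed.

(** In the quadratic bound for the exponential the linear term averages to 0, the mean of z z^T
    being the covariance. The quadratic term is controlled by the two exponential moments, with 516
    = 256 * 2 + 4. *)
Lemma rademacher_mexp l x c w : uniq l -> (forall y, qf (cov l) y <= sqn y) ->
  0 <= c <= 64^-1 -> `|w| = c ->
  \sum_e qf (mexp (w *: (rsum l e *m (rsum l e)^T - cov l))) x <=
  nsigns * (sqn x + 516 * c ^+ 2 * expR (\sum_(i <- l) sqn (u i)) * qf (cov l) x).
Proof.
move=> ul hl /andP[c0 c1] wc; set t := qf (cov l) x; set E := expR (\sum_(i <- l) _).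
have t0 : 0 <= t by rewrite /t qf_cov; apply: sumr_ge0 => i _; exact: sqr_ge0.
have /andP[w1 w2] : - c <= w <= c by rewrite -ler_norml wc.
have w2c : w ^+ 2 = c ^+ 2 by rewrite -wc real_normK ?num_real.
have m2 := sqr_moment x ul; rewrite -qf_cov -/t in m2.
have me := exp_moment ul hl; rewrite -/E in me.
have mx := exp_sqr_moment x ul hl; rewrite -/E -/t in mx.
have ec : expR c <= 2.
  have /expR_le_1D4x : 0 <= c <= 1 by apply/andP; split=> //; lra.
  by move=> ?; lra.
apply: (@le_trans _ _ (\sum_e (sqn x - w * t + w * inner (rsum l e) x ^+ 2 +
   c ^+ 2 * (256 * (expR (32^-1 * sqn (rsum l e)) * inner (rsum l e) x ^+ 2)
             + 4 * t * expR (16^-1 * sqn (rsum l e)))))).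
  apply: ler_sum => e _; set z := rsum l e.
  pose Z := w *: (z *m z^T - cov l); rewrite -/Z.
  have sZ : Z^T = Z by rewrite trmxZ linearB /= trmx_mul trmxK cov_sym.
  have qZ y : qf Z y = w * (inner z y ^+ 2 - qf (cov l) y).
    by rewrite qfZ qfD qfN qf_outer.
  have z0 := sqn_ge0 z.
  have s0 : 0 <= c * (sqn z + 1) by rewrite mulr_ge0 // addr_ge0.
  have hZ y : qf Z y <= c * (sqn z + 1) * sqn y.
    have q0 : 0 <= qf (cov l) y by rewrite qf_cov; apply: sumr_ge0 => i _; exact: sqr_ge0.
    rewrite qZ -mulrA mulrDl mul1r.
    apply: (@le_trans _ _ (c * (inner z y ^+ 2 + qf (cov l) y))).
      by have := sqr_ge0 (inner z y); nra.
    by rewrite ler_wpM2l // lerD // inner_sqr_le.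
  apply: (le_trans (qf_mexp_le_quadratic x sZ s0 hZ)).
  rewrite qZ -/t.
  have hs : sqn (Z *m x) <= 2 * c ^+ 2 * (sqn z * inner z x ^+ 2 + t).
    rewrite /Z -scalemxAl sqn_scale w2c -mulrA mulrCA ler_wpM2l ?sqr_ge0 //.
    have -> : (z *m z^T - cov l) *m x = inner z x *: z - cov l *m x.
      by rewrite mulmxBl -mulmxA (mx11_scalar (z^T *m x)) mul_mx_scalar.
    have := sqn_cov_le x hl; rewrite -/t.
    set a := inner z x *: z; set b := cov l *m x.
    have : sqn (a - b) <= 2 * (sqn a + sqn b).
      rewrite /sqn -big_split mulr_sumr; apply: ler_sum => i _ /=.
      rewrite [(a - b) i 0]mxE [(- b) i 0]mxE.
      by have := sqr_ge0 (a i 0 + b i 0); lra.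
    by rewrite [sqn a]sqn_scale; nra.
  set y2 := inner z x ^+ 2 in hs *; have y0 : 0 <= y2 by exact: sqr_ge0.
  (* Everything is measured in powers of f: |z|^2 <= 64 f, and exp (c (|z|^2 + 1)) <= 2 f because c
     <= 1/64. *)
  set f := expR (64^-1 * sqn z).
  have f1 : 1 <= f by rewrite /f -expR0 ler_expR mulr_ge0.
  have fz : sqn z <= 64 * f by have := expR_ge1Dx (64^-1 * sqn z); rewrite -/f; lra.
  have -> : expR (32^-1 * sqn z) = f ^+ 2 by rewrite /f -expRM_natl; congr expR; field.
  have -> : expR (16^-1 * sqn z) = f ^+ 4 by rewrite /f -expRM_natl; congr expR; field.
  have es : expR (c * (sqn z + 1)) <= 2 * f.
    rewrite mulrDr mulr1 expRD mulrC ler_pM ?expR_ge0 // /f ler_expR.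
    by rewrite ler_wpM2r.
  have h1 : expR (c * (sqn z + 1)) * sqn (Z *m x) <= 2 * f * (2 * c ^+ 2 * (sqn z * y2 + t)).
    by rewrite ler_pM ?expR_ge0 ?sqn_ge0.
  have f4 : f <= f ^+ 4 by rewrite -{1}(expr1 f) ler_weXn2l.
  have h2 : f * (sqn z * y2 + t) <= 64 * (f ^+ 2 * y2) + f ^+ 4 * t.
    have : f * t <= f ^+ 4 * t by rewrite ler_wpM2r.
    have : f * y2 * sqn z <= f * y2 * (64 * f) by rewrite ler_wpM2l // mulr_ge0 // (le_trans ler01).
    by nra.
  have h3 : 4 * c ^+ 2 * (f * (sqn z * y2 + t)) <= 4 * c ^+ 2 * (64 * (f ^+ 2 * y2) + f ^+ 4 * t).
    by rewrite ler_wpM2l // mulr_ge0 ?sqr_ge0.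
  by lra.
rewrite !big_split /= !sum_nsigns -!mulr_sumr m2 big_split /= -!mulr_sumr.
have h1 : c ^+ 2 * (256 * \sum_e expR (32^-1 * sqn (rsum l e)) * inner (rsum l e) x ^+ 2 +
   4 * t * \sum_e expR (16^-1 * sqn (rsum l e))) <=
   c ^+ 2 * (256 * (nsigns * (2 * E * t)) + 4 * t * (nsigns * E)).
  rewrite ler_wpM2l ?sqr_ge0 // lerD // ler_wpM2l // mulr_ge0 //.
by lra.
Qed.

End Rademacher.

(** * The subspace embedding property *)

Section RowPeeling.
Context {R : realType}.
Variables (N d zeta : nat).
Implicit Types (s : sign_seed d N) (i j : 'I_N) (r : 'I_d) (l : seq 'I_d).

(** Only the support of column [i] moves, so invariance under these maps expresses that the rows not
    yet revealed are exchangeable in each column separately. *)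
Definition swap_rows i (r r' : 'I_d) s : sign_seed d N :=
  [ffun j => if j == i then (tperm r r' @: (s j).1, (s j).2) else s j].

Lemma swap_rowsK i r r' : involutive (swap_rows i r r').
Proof.
move=> s; apply/ffunP => j; rewrite !ffunE; case: eqVneq => // _ /=.
rewrite -imset_comp (eq_imset (g := id)) ?imset_id; first by case: (s j).
by move=> x /=; rewrite tpermK.
Qed.

Lemma swap_rows_seeds i r r' s :
  (swap_rows i r r' s \in sign_seeds d N zeta) = (s \in sign_seeds d N zeta).
Proof.
rewrite !inE; apply: eq_forallb => j; rewrite ffunE; case: (j =P i) => // _ /=.
by rewrite card_imset //; exact: perm_inj.
Qed.

Lemma mem_swap_rows i r r' s r0 :
  (r0 \in (swap_rows i r r' s i).1) = (tperm r r' r0 \in (s i).1).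
Proof.
by rewrite ffunE eqxx /= -{1}[r0](tpermK r r') mem_imset //; exact: perm_inj.
Qed.

Definition swap_inv l i (g : sign_seed d N -> R) :=
  forall r r' s, r \notin l -> r' \notin l -> g (swap_rows i r r' s) = g s.

(* Transposing r with another row outside l does not change g, so all the rows
   outside l are hit equally often. *)
Lemma sum_hit_column l i r (g : sign_seed d N -> R) (p : R) :
  uniq l -> r \notin l -> (forall s, 0 <= g s) -> swap_inv l i g ->
  zeta%:R <= p * (d - size l)%:R ->
  \sum_(s in sign_seeds d N zeta) (r \in (s i).1)%:R * g s <=
  p * \sum_(s in sign_seeds d N zeta) g s.
Proof.
move=> ul rl g0 gi hp.
pose H r := \sum_(s in sign_seeds d N zeta) (r \in (s i).1)%:R * g s.
have cardl : #|[pred r | r \notin l]| = (d - size l)%N.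
  have := cardC [in l]; rewrite card_ord (card_uniqP ul) => h.
  by rewrite -[X in (X - _)%N]h addKn; apply: eq_card => x; rewrite !inE.
have HE r' : r' \notin l -> H r' = H r.
  move=> r'l; rewrite /H (reindex_inj (inv_inj (swap_rowsK i r r'))).
  apply: eq_big => s; first exact: swap_rows_seeds.
  by move=> _; rewrite mem_swap_rows tpermR gi.
have sumH : (d - size l)%:R * H r = \sum_(r' | r' \notin l) H r'.
  by rewrite (eq_bigr (fun=> H r)) // sumr_const cardl mulr_natl.
have : \sum_(r' | r' \notin l) H r' <= zeta%:R * \sum_(s in sign_seeds d N zeta) g s.
  rewrite exchange_big mulr_sumr; apply: ler_sum => s; rewrite inE => /forallP/(_ i)/eqP zs.
  rewrite -mulr_suml ler_wpM2r // -zs -sum1_card natr_sum.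
  rewrite big_mkcond [leRHS]big_mkcond /=; apply: ler_sum => r' _.
  by case: (r' \in l) => //=; case: (r' \in (s i).1).
rewrite -sumH -/(H r) => h.
have dl : 0 < (d - size l)%:R :> R.
  by rewrite ltr0n -cardl; apply/card_gt0P; exists r; rewrite inE.
rewrite -(ler_pM2l dl) (le_trans h) // mulrA [_ * p]mulrC ler_wpM2r //.
by apply: sumr_ge0 => s _.
Qed.

(** The columns are averaged out one at a time. The factors of the remaining columns are absorbed
    into [g], which stays invariant under swaps in the current one; as a >= b, an upper bound on the
    hit probability can be used. *)
Lemma sum_hit_columns l (L : seq 'I_N) r (g : sign_seed d N -> R) (a b : 'I_N -> R) (p : R) :
  uniq L -> uniq l -> r \notin l -> (forall s, 0 <= g s) -> (forall i, swap_inv l i g) ->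
  0 <= p -> zeta%:R <= p * (d - size l)%:R -> (forall i, 0 <= b i <= a i) ->
  \sum_(s in sign_seeds d N zeta) (\prod_(i <- L) (if r \in (s i).1 then a i else b i)) * g s <=
  (\prod_(i <- L) (b i + p * (a i - b i))) * \sum_(s in sign_seeds d N zeta) g s.
Proof.
move=> uL ul rl g0 gi p0 hp ab; elim: L uL => [_|i L IH /= /andP[iL uL]].
  by rewrite !big_nil mul1r; apply: ler_sum => s _; rewrite big_nil mul1r.
have [b0 ba] := andP (ab i).
pose g' s := (\prod_(i <- L) (if r \in (s i).1 then a i else b i)) * g s.
have g'0 s : 0 <= g' s.
  rewrite mulr_ge0 //; apply: prodr_ge0 => j _; have [h1 h2] := andP (ab j).
  by case: ifP => // _; exact: le_trans h1 h2.
have g'i : swap_inv l i g'.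
  move=> r1 r2 s h1 h2; rewrite /g' gi //; congr (_ * _).
  rewrite !big_seq; apply: eq_bigr => j jL; rewrite ffunE.
  by case: (j =P i) jL => [->|//]; rewrite (negPf iL).
have h := sum_hit_column ul rl g'0 g'i hp.
rewrite (eq_bigr (fun s => b i * g' s + (a i - b i) * ((r \in (s i).1)%:R * g' s))); last first.
  by move=> s _; rewrite big_cons /g'; case: ifP => _ /=; ring.
rewrite big_split -!mulr_sumr /= big_cons -mulrA.
apply: (@le_trans _ _ ((b i + p * (a i - b i)) * \sum_(s in sign_seeds d N zeta) g' s)).
  rewrite [leRHS]mulrDl lerD2l -mulrA [leRHS]mulrCA.
  by rewrite ler_wpM2l // subr_ge0.
by rewrite ler_wpM2l ?IH // addr_ge0 // mulr_ge0 // subr_ge0.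
Qed.

(** Averaging over [e] gives row [r] fresh uniform signs and leaves the other rows alone. *)
Definition xor_row r (e : {ffun 'I_N -> bool}) s : sign_seed d N :=
  [ffun j => ((s j).1, [ffun r' => (r' == r) && e j (+) (s j).2 r'])].

Lemma xor_rowK r e : involutive (xor_row r e).
Proof.
move=> s; apply/ffunP => j; rewrite !ffunE /=; case: (s j) => T h /=.
by congr (_, _); apply/ffunP => r'; rewrite !ffunE addbA addbb.
Qed.

Lemma xor_row_seeds r e s :
  (xor_row r e s \in sign_seeds d N zeta) = (s \in sign_seeds d N zeta).
Proof. by rewrite !inE; apply: eq_forallb => j; rewrite ffunE. Qed.

Definition hits r s : seq 'I_N := [seq j <- enum 'I_N | r \in (s j).1].
Definition row_signs r s : {ffun 'I_N -> bool} := [ffun j => (s j).2 r].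

Variables (k : nat) (u : 'I_N -> 'cV[R]_k).
Hypothesis covu : cov u (enum 'I_N) = 1%:M.

Definition row_dev_of (J : seq 'I_N) (e : {ffun 'I_N -> bool}) : 'M[R]_k :=
  rsum u J e *m (rsum u J e)^T - cov u J.

Definition row_dev r s := row_dev_of (hits r s) (row_signs r s).

Lemma row_dev_of_sym J e : (row_dev_of J e)^T = row_dev_of J e.
Proof. by rewrite linearB /= trmx_mul trmxK cov_sym. Qed.

Definition rows_dev l s := \sum_(r <- l) row_dev r s.

Lemma rows_dev_cons r l s : rows_dev (r :: l) s = row_dev r s + rows_dev l s.
Proof. by rewrite /rows_dev big_cons. Qed.

Lemma rows_dev_sym l s : (rows_dev l s)^T = rows_dev l s.
Proof. by rewrite /rows_dev raddf_sum; apply: eq_bigr => r _; exact: row_dev_of_sym. Qed.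

Lemma rows_dev_swap l i r r' s : r \notin l -> r' \notin l ->
  rows_dev l (swap_rows i r r' s) = rows_dev l s.
Proof.
move=> rl r'l; rewrite /rows_dev !big_seq; apply: eq_bigr => r0 r0l.
rewrite /row_dev; congr row_dev_of.
  apply: eq_filter => j; have [->|ji] := eqVneq j i.
    rewrite mem_swap_rows tpermD //; first by apply: contraNneq rl => ->.
    by apply: contraNneq r'l => ->.
  by rewrite ffunE (negPf ji).
by apply/ffunP => j; rewrite !ffunE; case: (j =P i).
Qed.

Lemma rows_dev_xor l r e s : r \notin l -> rows_dev l (xor_row r e s) = rows_dev l s.
Proof.
move=> rl; rewrite /rows_dev !big_seq; apply: eq_bigr => r0 r0l.
rewrite /row_dev; congr row_dev_of.
  by apply: eq_filter => j; rewrite ffunE.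
apply/ffunP => j; rewrite !ffunE; case: (r0 =P r) => // E.
by rewrite -E r0l in rl.
Qed.

Lemma row_dev_xor r e s :
  row_dev r (xor_row r e s) = row_dev_of (hits r s) [ffun j => e j (+) row_signs r s j].
Proof.
rewrite /row_dev; congr row_dev_of; first by apply: eq_filter => j; rewrite ffunE.
by apply/ffunP => j; rewrite !ffunE eqxx.
Qed.

Lemma cov_hits_le r s y : qf (cov u (hits r s)) y <= sqn y.
Proof.
rewrite -qf1 -covu !qf_cov big_filter big_mkcond; apply: ler_sum => j _.
by case: ifP => // _; exact: sqr_ge0.
Qed.

Lemma sum_sqn_frame : \sum_j sqn (u j) = k%:R.
Proof.
rewrite -(mxtrace1 R k) -covu /cov big_enum raddf_sum; apply: eq_bigr => j _ /=.
by rewrite mxtrace_mulC -sqnE /mxtrace big_ord_recl big_ord0 addr0.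
Qed.

Lemma sqn_frame_le1 j : sqn (u j) <= 1.
Proof.
have : inner (u j) (u j) ^+ 2 <= sqn (u j).
  rewrite -[leRHS]qf1 -covu qf_cov big_enum (bigD1 j) //= lerDl.
  by apply: sumr_ge0 => i _; exact: sqr_ge0.
rewrite [inner _ _]sqnE; have := sqn_ge0 (u j); nra.
Qed.

Lemma mxtrace_mul_cov (H : 'M[R]_k) J : \tr (H *m cov u J) = \sum_(j <- J) qf H (u j).
Proof.
rewrite /cov mulmx_sumr raddf_sum; apply: eq_bigr => j _ /=.
by rewrite mulmxA mxtrace_mulC mulmxA /mxtrace big_ord_recl big_ord0 addr0.
Qed.

Definition potential (w : R) l : R :=
  \sum_(s in sign_seeds d N zeta) \tr (mexp (w *: rows_dev l s)).

(** The trace is a sum over hit columns j, and the indicator that j is hit times the exponential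
    weight is a product over all columns. Column j contributes at most 3 p, the others together at
    most exp 4 <= 81 since p k <= 1; hence 243. *)
Lemma sum_covered_mexp w l r p :
  uniq l -> r \notin l -> 0 <= p -> p * k%:R <= 1 -> zeta%:R <= p * (d - size l)%:R ->
  \sum_(s in sign_seeds d N zeta)
     expR (\sum_(j <- hits r s) sqn (u j)) * \tr (mexp (w *: rows_dev l s) *m cov u (hits r s))
  <= 243 * p * potential w l.
Proof.
move=> ul rl p0 pk hp.
have sA s : (w *: rows_dev l s)^T = w *: rows_dev l s by rewrite trmxZ rows_dev_sym.
pose G j s := qf (mexp (w *: rows_dev l s)) (u j).
pose a i : R := expR (sqn (u i)).
have a1 i : 1 <= a i by rewrite /a -expR0 ler_expR sqn_ge0.
(* A column that misses the row has weight 1, except [j] itself, where the weight 0 forces a hit. *)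
have E s : expR (\sum_(j <- hits r s) sqn (u j)) * \tr (mexp (w *: rows_dev l s) *m cov u (hits r s)) =
   \sum_j (\prod_(i <- enum 'I_N) (if r \in (s i).1 then a i else (i != j)%:R)) * G j s.
  rewrite mxtrace_mul_cov mulr_sumr big_filter big_enum_cond big_mkcond /=; apply: eq_bigr => j _.
  rewrite big_enum /=; case: ifP => rj; last first.
    by rewrite (bigD1 j) //= rj eqxx /= !mul0r.
  congr (_ * _); rewrite expR_sum /hits big_filter big_enum_cond big_mkcond /=.
  apply: eq_bigr => i _; case: ifP => // ri.
  by case: eqVneq => // ij; rewrite ij rj in ri.
rewrite (eq_bigr _ (fun s _ => E s)) exchange_big /=.
apply: (@le_trans _ _ (\sum_j 243 * p * \sum_(s in sign_seeds d N zeta) G j s)).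
  apply: ler_sum => j _.
  have := @sum_hit_columns l (enum 'I_N) r (G j) a (fun i => (i != j)%:R) p (enum_uniq _) ul rl.
  move=> /(_ _ _ p0 hp _)/le_trans; apply.
  - by move=> s; exact: qf_mexp_ge0.
  - by move=> i r1 r2 s h1 h2; rewrite /G rows_dev_swap.
  - by move=> i; rewrite ler0n (le_trans _ (a1 i)) // lern1 leq_b1.
  rewrite ler_wpM2r //; first by apply: sumr_ge0 => s _; exact: qf_mexp_ge0.
  rewrite big_enum (bigD1 j) //= eqxx /= add0r subr0.
  have aj : a j <= 3 by apply: le_trans expR1_le3; rewrite ler_expR sqn_frame_le1.
  have : \prod_(i | i != j) ((i != j)%:R + p * (a i - (i != j)%:R)) <= 81.
    apply: (@le_trans _ _ (\prod_(i | i != j) expR (4 * p * sqn (u i)))).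
      apply: ler_prod => i ->; rewrite addr_ge0 ?mulr_ge0 ?subr_ge0 //=.
      apply: le_trans (expR_ge1Dx _).
      have : a i <= 1 + 4 * sqn (u i) by apply: expR_le_1D4x; rewrite sqn_ge0 sqn_frame_le1.
      by move=> ai; rewrite lerD2l [4 * p]mulrC -mulrA ler_wpM2l //; lra.
    rewrite -expR_sum -mulr_sumr.
    apply: (@le_trans _ _ (expR (4%:R * 1))).
      rewrite ler_expR -mulrA ler_wpM2l //; apply: le_trans pk.
      rewrite ler_wpM2l // -sum_sqn_frame [leRHS](bigD1 j) //= lerDr sqn_ge0 //.
    rewrite expRM_natl; apply: (@le_trans _ _ (3 ^+ 4)); last by lra.
    by rewrite lerXn2r ?nnegrE ?expR_ge0 ?expR1_le3.
  move=> h; apply: (@le_trans _ _ (p * 3 * 81)); last by lra.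
  rewrite ler_pM ?mulr_ge0 //; first by rewrite (le_trans ler01).
    apply: prodr_ge0 => i ->; rewrite addr_ge0 ?mulr_ge0 ?subr_ge0 //.
  by rewrite ler_wpM2l.
rewrite -mulr_sumr exchange_big /=; apply: ler_wpM2l; first exact: (mulr_ge0 (ler0n _ _)).
apply: ler_sum => s _.
by rewrite -[mexp _]mulmx1 -covu mxtrace_mul_cov big_enum.
Qed.

(** 516 is the cost of averaging the signs of a row, 243 that of averaging its hits. *)
Definition peel_rate (c p : R) : R := 516 * 243 * c ^+ 2 * p.

Lemma peel_rate_ge0 c p : 0 <= p -> 0 <= peel_rate c p.
Proof.
by move=> p0; apply: mulr_ge0 p0; exact: (mulr_ge0 (mulr_ge0 (ler0n _ _) (ler0n _ _)) (sqr_ge0 c)).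
Qed.

(** Golden-Thompson separates the new row from the exponential of the others. Averaging its signs
    leaves 1 plus a multiple of c^2 times the covariance of its hits, and averaging the hits turns
    that covariance into a factor O(p). *)
Lemma potential_cons w c l r p :
  uniq l -> r \notin l -> 0 <= p -> p * k%:R <= 1 -> zeta%:R <= p * (d - size l)%:R ->
  0 <= c <= 64^-1 -> `|w| = c ->
  potential w (r :: l) <= (1 + peel_rate c p) * potential w l.
Proof.
move=> ul rl p0 pk hp hc wc.
have n0 := nsigns_gt0 (R := R) 'I_N.
have sA s : (w *: rows_dev l s)^T = w *: rows_dev l s by rewrite trmxZ rows_dev_sym.
rewrite -(ler_pM2l n0) -sum_nsigns.
(* Each substitution [xor_row r e] rewrites the same potential; averaging over [e] brings the mean
   over row signs inside. *)
have E (e : {ffun 'I_N -> bool}) : potential w (r :: l) = \sum_(s in sign_seeds d N zeta)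
    \tr (mexp (w *: row_dev_of (hits r s) [ffun j => e j (+) row_signs r s j] + w *: rows_dev l s)).
  rewrite /potential (reindex_inj (inv_inj (xor_rowK r e))).
  apply: eq_big => s; first exact: xor_row_seeds.
  by move=> _; rewrite rows_dev_cons row_dev_xor rows_dev_xor // scalerDr.
rewrite (eq_bigr _ (fun e _ => E e)) exchange_big /=.
apply: (@le_trans _ _ (\sum_(s in sign_seeds d N zeta) nsigns 'I_N * (
    \tr (mexp (w *: rows_dev l s)) + 516 * c ^+ 2 *
     (expR (\sum_(j <- hits r s) sqn (u j)) * \tr (mexp (w *: rows_dev l s) *m cov u (hits r s)))))).
  apply: ler_sum => s _; set J := hits r s; set H := mexp (w *: rows_dev l s).
  have bij : injective (fun e : {ffun 'I_N -> bool} => [ffun j => e j (+) row_signs r s j]).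
    move=> e1 e2 /ffunP h; apply/ffunP => j; have := h j; rewrite !ffunE.
    exact: addIb.
  rewrite -(reindex_inj bij (P := xpredT) (F := fun e => \tr (mexp (w *: row_dev_of J e + w *: rows_dev l s)))).
  apply: (@le_trans _ _ (\tr (H *m \sum_e mexp (w *: row_dev_of J e)))).
    rewrite mulmx_sumr [leRHS]raddf_sum; apply: ler_sum => e _ /=.
    rewrite addrC; apply: golden_thompson => //.
    by rewrite trmxZ row_dev_of_sym.
  have : forall x, qf (\sum_e mexp (w *: row_dev_of J e)) x <=
    qf (nsigns 'I_N *: (1%:M + (516 * c ^+ 2 * expR (\sum_(j <- J) sqn (u j))) *: cov u J)) x.
    move=> x; rewrite qf_sum qfZ qfD qfZ qf1.
    apply: rademacher_mexp => //; first by rewrite filter_uniq ?enum_uniq.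
    exact: cov_hits_le.
  move=> /(mxtrace_mexp_le (sA s))/le_trans; apply.
  rewrite -scalemxAr mulmxDr mulmx1 -scalemxAr !linearZ /= raddfD /= linearZ /=.
  by rewrite !mulrA.
rewrite -mulr_sumr ler_wpM2l ?(ltW n0) // big_split /= -mulr_sumr [leRHS]mulrDl mul1r lerD2l.
have h := sum_covered_mexp w ul rl p0 pk hp.
have c2 : 0 <= 516 * c ^+ 2 by apply: mulr_ge0; [exact: ler0n | exact: sqr_ge0].
apply: (le_trans (ler_wpM2l c2 h)); move: (potential w l) => Q.
by rewrite /peel_rate le_eqVlt; apply/orP; left; apply/eqP; ring.
Qed.

Lemma potential_le w c l p :
  uniq l -> 0 <= p -> p * k%:R <= 1 -> zeta%:R <= p * (d - size l)%:R ->
  0 <= c <= 64^-1 -> `|w| = c ->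
  potential w l <= (1 + peel_rate c p) ^+ size l * (k%:R * #|sign_seeds d N zeta|%:R).
Proof.
move=> ul p0 pk hp hc wc; elim: l ul hp => [_ _|r l IH /= /andP[rl ul] hp].
  rewrite expr0 mul1r mulr_natr -sumr_const; apply: ler_sum => s _.
  by rewrite /rows_dev big_nil scaler0; exact: mxtrace_mexp0.
have hp' : zeta%:R <= p * (d - size l)%:R.
  by apply: le_trans hp _; rewrite ler_wpM2l // ler_nat leq_sub2l.
apply: (le_trans (potential_cons ul rl p0 pk hp' hc wc)).
have k0 : 0 <= 1 + peel_rate c p by rewrite addr_ge0 // peel_rate_ge0.
by rewrite /= exprS -mulrA ler_wpM2l // IH.
Qed.

(** The sign of [w] selects the upper or the lower tail. *)
Definition large_dev t w l s : Prop :=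
  exists2 v : 'cV[R]_k, v != 0 & t * sqn v <= w * qf (rows_dev l s) v.

(** Markov's inequality: each counted seed contributes at least exp t to the potential. *)
Lemma count_large_rows_dev w c l p t :
  uniq l -> 0 <= p -> p * k%:R <= 1 -> zeta%:R <= p * (d - size l)%:R ->
  0 <= c <= 64^-1 -> `|w| = c ->
  #|[set s in sign_seeds d N zeta | `[< large_dev t w l s >]]|%:R
   * expR t <= (1 + peel_rate c p) ^+ size l * (k%:R * #|sign_seeds d N zeta|%:R).
Proof.
move=> ul p0 pk hp hc wc; apply: le_trans (potential_le ul p0 pk hp hc wc).
have sA s : (w *: rows_dev l s)^T = w *: rows_dev l s by rewrite trmxZ rows_dev_sym.
rewrite mulr_natl -sumr_const [leRHS](bigID (fun s =>
   `[< large_dev t w l s >])) /=.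
rewrite (eq_bigl (fun s => (s \in sign_seeds d N zeta) &&
   `[< large_dev t w l s >])); last by move=> s; rewrite inE.
apply: (@le_trans _ _ (\sum_(s in sign_seeds d N zeta |
   `[< large_dev t w l s >]) \tr (mexp (w *: rows_dev l s)))).
  apply: ler_sum => s /andP[_ /asboolP[v v0 hv]].
  by apply: mxtrace_mexp_ge v0 _ => //; rewrite qfZ.
by rewrite lerDl; apply: sumr_ge0 => s _; exact: mxtrace_mexp_ge0.
Qed.

(** With p = 1 / k, peeling k zeta rows costs at most exp (516 * 243 * c^2 zeta). As 516 * 243 <=
    2^18, the choice c = 2^-21 bounds this by exp (c zeta / 8), half of the exponent c zeta / 4
    gained from the deviation. *)
Lemma count_rows_dev_tail w l (c := 2 ^- 21 : R) :
  (0 < k)%N -> uniq l -> size l = (k * zeta)%N -> d = (k * zeta + k * zeta)%N ->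
  `|w| = c ->
  #|[set s in sign_seeds d N zeta | `[< large_dev (c * zeta%:R / 4) w l s >]]|%:R * expR (c * zeta%:R / 8)
   <= k%:R * #|sign_seeds d N zeta|%:R.
Proof.
move=> k0 ul sl dE wc.
have kR : 0 < k%:R :> R by rewrite ltr0n.
have c0 : 0 < c by rewrite invr_gt0 exprn_gt0.
have cK : c * 2 ^+ 21 = 1 by rewrite mulVf // expf_neq0.
have p0 : 0 <= k%:R^-1 :> R by rewrite invr_ge0 ltW.
have pk : k%:R^-1 * k%:R <= 1 :> R by rewrite mulVf // gt_eqF.
have hp : zeta%:R <= k%:R^-1 * (d - size l)%:R :> R.
  by rewrite sl [X in (X - _)%N]dE addnK natrM mulKf // gt_eqF.
have c64 : 0 <= c <= 64^-1.
  have -> : 64 = 2 ^+ 6 :> R by rewrite -natrX.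
  by rewrite (ltW c0) /= /c lef_pV2 ?posrE ?exprn_gt0 // ler_eXn2l // ltr1n.
have := count_large_rows_dev (c * zeta%:R / 4) ul p0 pk hp c64 wc.
set B := #|_|%:R; set n := #|sign_seeds _ _ _|%:R => h.
have h1 : (1 + peel_rate c k%:R^-1) ^+ size l <= expR (c * zeta%:R / 8).
  apply: (@le_trans _ _ (expR (peel_rate c k%:R^-1) ^+ size l)).
    rewrite lerXn2r ?nnegrE ?expR_ge0 ?expR_ge1Dx //.
    by rewrite addr_ge0 // peel_rate_ge0.
  rewrite -expRM_natl sl natrM ler_expR.
  have -> : k%:R * zeta%:R * (peel_rate c k%:R^-1) = c * zeta%:R * (516 * 243 * c).
    by rewrite /peel_rate; field; rewrite gt_eqF.
  rewrite ler_wpM2l ?mulr_ge0 ?(ltW c0) //.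
  have K : 516 * 243 <= 2 ^+ 18 :> R.
    apply: (@le_trans _ _ (2 ^+ 10 * 2 ^+ 8)); last by rewrite -exprD.
    have a : 516 <= 2 ^+ 10 :> R by rewrite -natrX ler_nat.
    have b : 243 <= 2 ^+ 8 :> R by rewrite -natrX ler_nat.
    exact: (ler_pM (ler0n _ _) (ler0n _ _) a b).
  apply: (@le_trans _ _ (2 ^+ 18 * c)); first by rewrite ler_wpM2r // ltW.
  have : 2 ^+ 3 * (2 ^+ 18 * c) = 1 by rewrite mulrA -exprD mulrC.
  by lra.
have e8 : expR (c * zeta%:R / 4) = expR (c * zeta%:R / 8) * expR (c * zeta%:R / 8).
  by rewrite -expRD; congr expR; field.
have e0 := expR_gt0 (c * zeta%:R / 8).
rewrite -(ler_pM2r e0) -[leLHS]mulrA -e8 (le_trans h) // mulrC ler_wpM2l //.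
by rewrite mulr_ge0 // ltW.
Qed.

Definition frame_mx : 'M[R]_(N, k) := \matrix_(i, j) u i j 0.

(** Entry r of the sketch is <z_r, v> up to the factor zeta^(-1/2). As every column has exactly zeta
    hits, the covariances V of the rows add up to zeta times the identity, so subtracting them
    amounts to subtracting |v|^2. *)
Lemma sqn_sketch s v : s \in sign_seeds d N zeta -> (0 < zeta)%N ->
  sqn (sparse_sign_mx R zeta s *m (frame_mx *m v)) - sqn v =
  zeta%:R^-1 * qf (rows_dev (enum 'I_d) s) v.
Proof.
move=> ss z0; have zR : 0 < zeta%:R :> R by rewrite ltr0n.
have entry r : (sparse_sign_mx R zeta s *m (frame_mx *m v)) r 0 =
    (Num.sqrt zeta%:R)^-1 * inner (rsum u (hits r s) (row_signs r s)) v.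
  have -> : inner (rsum u (hits r s) (row_signs r s)) v =
      \sum_j (if r \in (s j).1 then (-1) ^+ (s j).2 r * inner (u j) v else 0).
    rewrite [RHS](_ : _ = \sum_(j <- hits r s) (-1) ^+ (s j).2 r * inner (u j) v); last first.
      by rewrite /hits big_filter big_enum_cond [RHS]big_mkcond.
    rewrite /rsum; elim: (hits r s) => [|j J IH].
      by rewrite !big_nil innerE big1 // => i _; rewrite mxE mul0r.
    by rewrite !big_cons innerD innerZ IH ffunE.
  rewrite mxE mulr_sumr; apply: eq_bigr => j _; rewrite !mxE.
  have -> : \sum_j0 frame_mx j j0 * v j0 0 = inner (u j) v.
    by rewrite innerE; apply: eq_bigr => i _; rewrite mxE.
  by case: ifP => _; [rewrite mulrAC mulrC | rewrite mul0r mulr0].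
have sumV : \sum_r qf (cov u (hits r s)) v = zeta%:R * sqn v.
  rewrite -qf1 -covu qf_cov big_enum mulr_sumr /=.
  rewrite (eq_bigr (fun r => \sum_j (if r \in (s j).1 then inner (u j) v ^+ 2 else 0))); last first.
    by move=> r _; rewrite qf_cov big_filter big_enum_cond big_mkcond.
  rewrite exchange_big; apply: eq_bigr => j _ /=.
  rewrite -big_mkcond sumr_const /=; move: ss; rewrite inE => /forallP/(_ j)/eqP ->.
  by rewrite mulr_natl.
rewrite /rows_dev qf_sum big_enum /= (eq_bigr (fun r => inner (rsum u (hits r s) (row_signs r s)) v ^+ 2
   - qf (cov u (hits r s)) v)); last by move=> r _; rewrite qfD qfN qf_outer.
rewrite sumrB sumV mulrBr mulKf ?gt_eqF //; congr (_ - _).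
by rewrite /sqn mulr_sumr; apply: eq_bigr => r _; rewrite entry exprMn exprVn sqr_sqrtr.
Qed.

(** Union bound over two halves and two tails, whence the 4. Outside these events each half deviates
    by at most zeta / 4, so both together by at most zeta / 2. *)
Lemma count_bad_sketch (c := 2 ^- 21 : R) :
  (0 < k)%N -> (0 < zeta)%N -> d = (k * zeta + k * zeta)%N ->
  #|[set s in sign_seeds d N zeta | ~~ `[< forall v,
       `|sqn (sparse_sign_mx R zeta s *m (frame_mx *m v)) - sqn v| <= 2^-1 * sqn v >]]|%:R
    * expR (c * zeta%:R / 8) <= 4 * k%:R * #|sign_seeds d N zeta|%:R.
Proof.
move=> k0 z0 dE.
have zR : 0 < zeta%:R :> R by rewrite ltr0n.
have c0 : 0 < c by rewrite invr_gt0 exprn_gt0.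
pose l1 := take (k * zeta)%N (enum 'I_d); pose l2 := drop (k * zeta)%N (enum 'I_d).
have ul1 : uniq l1 by rewrite take_uniq ?enum_uniq.
have ul2 : uniq l2 by rewrite drop_uniq ?enum_uniq.
have sl1 : size l1 = (k * zeta)%N.
  by rewrite size_takel // size_enum_ord dE leq_addr.
have sl2 : size l2 = (k * zeta)%N.
  by rewrite size_drop size_enum_ord [X in (X - _)%N]dE addnK.
pose B w l := [set s in sign_seeds d N zeta | `[< large_dev (c * zeta%:R / 4) w l s >]].
have nc : `|c| = c by rewrite gtr0_norm.
have nNc : `|- c| = c by rewrite normrN.
have h1 : #|B c l1|%:R * expR (c * zeta%:R / 8) <= k%:R * #|sign_seeds d N zeta|%:R :=
  count_rows_dev_tail k0 ul1 sl1 dE nc.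
have h2 : #|B c l2|%:R * expR (c * zeta%:R / 8) <= k%:R * #|sign_seeds d N zeta|%:R :=
  count_rows_dev_tail k0 ul2 sl2 dE nc.
have h3 : #|B (- c) l1|%:R * expR (c * zeta%:R / 8) <= k%:R * #|sign_seeds d N zeta|%:R :=
  count_rows_dev_tail k0 ul1 sl1 dE nNc.
have h4 : #|B (- c) l2|%:R * expR (c * zeta%:R / 8) <= k%:R * #|sign_seeds d N zeta|%:R :=
  count_rows_dev_tail k0 ul2 sl2 dE nNc.
have e0 := expR_gt0 (c * zeta%:R / 8).
set bad := [set _ in _ | _].
have sub : bad \subset (B c l1 :|: B c l2) :|: (B (- c) l1 :|: B (- c) l2).
  apply/fintype.subsetP => s; rewrite inE => /andP[ss].
  have nl w l : s \notin B w l -> ~ large_dev (c * zeta%:R / 4) w l s.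
    by rewrite inE ss /= => /asboolPn.
  apply: contraNT; rewrite !finset.in_setU !negb_or.
  move=> /andP[/andP[/nl b1 /nl b2] /andP[/nl b3 /nl b4]].
  apply/asboolP => v; have [->|v0] := eqVneq v 0.
    rewrite !mulmx0 (_ : sqn 0 = 0) ?subrr ?normr0 ?mulr0 //; last by apply/eqP; rewrite sqn_eq0.
    by rewrite (_ : sqn 0 = 0) ?subrr ?normr0 ?mulr0 //; apply/eqP; rewrite sqn_eq0.
  have bnd w l : ~ large_dev (c * zeta%:R / 4) w l s ->
     w * qf (rows_dev l s) v <= c * zeta%:R / 4 * sqn v.
    by move=> nb; rewrite leNgt; apply/negP => lt; apply: nb; exists v => //; exact: ltW.
  have := bnd _ _ b1; have := bnd _ _ b2; have := bnd _ _ b3; have := bnd _ _ b4.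
  rewrite sqn_sketch // normrM gtr0_norm ?invr_gt0 //.
  have -> : rows_dev (enum 'I_d) s = rows_dev l1 s + rows_dev l2 s.
    by rewrite /rows_dev -{1}(cat_take_drop (k * zeta)%N (enum 'I_d)) big_cat.
  rewrite qfD; set q1 := qf _ v; set q2 := qf _ v => g4 g3 g2 g1.
  rewrite mulrC ler_pdivrMr // ler_norml.
  have f (x y : R) : c * x <= c * y -> x <= y by rewrite ler_pM2l.
  have i1 : q1 <= zeta%:R / 4 * sqn v by apply: f; lra.
  have i2 : q2 <= zeta%:R / 4 * sqn v by apply: f; lra.
  have i3 : - q1 <= zeta%:R / 4 * sqn v by apply: f; lra.
  have i4 : - q2 <= zeta%:R / 4 * sqn v by apply: f; lra.
  by apply/andP; split; lra.
have : (#|bad| <= #|B c l1| + #|B c l2| + (#|B (- c) l1| + #|B (- c) l2|))%N.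
  apply: (leq_trans (subset_leq_card sub)).
  apply: (leq_trans (leq_card_setU _ _)).
  by apply: leq_add; exact: leq_card_setU.
rewrite -(ler_nat R) !natrD => hb.
have : #|bad|%:R * expR (c * zeta%:R / 8) <= 
  (#|B c l1|%:R + #|B c l2|%:R + (#|B (- c) l1|%:R + #|B (- c) l2|%:R)) * expR (c * zeta%:R / 8).
  by rewrite ler_wpM2r // ltW.
by lra.
Qed.

End RowPeeling.

(** * Conditioning of the preconditioned matrix *)

Section ConditionNumber.
Context {R : realType}.
Local Open Scope classical_set_scope.

Lemma l2normE n (x : 'cV[R]_n) : l2norm x = Num.sqrt (sqn x).
Proof. by []. Qed.

Lemma energy_normE n (M : 'M[R]_n) z : energy_norm M z = Num.sqrt (qf M z).
Proof. by []. Qed.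

Lemma sqn0 n : sqn (0 : 'cV[R]_n) = 0.
Proof. by apply/eqP; rewrite sqn_eq0. Qed.

Lemma l2norm0 n : l2norm (0 : 'cV[R]_n) = 0.
Proof. by rewrite l2normE sqn0 sqrtr0. Qed.

Lemma l2norm_le_mul m n (x : 'cV[R]_n) (y : 'cV[R]_m) c : 0 <= c ->
  sqn x <= c ^+ 2 * sqn y -> l2norm x <= c * l2norm y.
Proof.
move=> c0 h; rewrite !l2normE -{1}(ger0_norm c0) -sqrtr_sqr -sqrtrM ?sqr_ge0 //.
exact: ler_wsqrtr.
Qed.

(** Ensures that the supremum in [spectral_norm] is that of a bounded set; the constant is the
    Frobenius norm. *)
Lemma l2norm_mulmx_bounded m n (A : 'M[R]_(m, n)) :
  exists2 c, 0 <= c & forall x, l2norm (A *m x) <= c * l2norm x.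
Proof.
exists (Num.sqrt (\sum_i sqn (row i A)^T)); first exact: sqrtr_ge0.
move=> x; apply: l2norm_le_mul; first exact: sqrtr_ge0.
rewrite sqr_sqrtr; last by apply: sumr_ge0 => i _; exact: sqn_ge0.
rewrite /sqn mulr_suml; apply: ler_sum => i _.
have -> : (A *m x) i 0 = inner (row i A)^T x.
  by rewrite /inner trmxK -row_mul [RHS]mxE.
exact: inner_sqr_le.
Qed.

Lemma spectral_norm_le m n (A : 'M[R]_(m, n)) c : 0 <= c ->
  (forall x, sqn (A *m x) <= c ^+ 2 * sqn x) -> spectral_norm A <= c.
Proof.
move=> c0 h; apply: ge_sup.
  by exists (l2norm (A *m 0)), 0 => //=; rewrite l2norm0.
move=> _ [x /= x1 <-]; apply: (le_trans (l2norm_le_mul c0 (h x))).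
by rewrite ler_piMr.
Qed.

Lemma spectral_norm_ub m n (A : 'M[R]_(m, n)) x :
  l2norm x <= 1 -> l2norm (A *m x) <= spectral_norm A.
Proof.
move=> x1; have [c c0 hc] := l2norm_mulmx_bounded A.
apply: ub_le_sup; last by exists x.
by exists c => _ [y /= y1 <-]; apply: (le_trans (hc y)); rewrite ler_piMr.
Qed.

Lemma spectral_norm_ge0 m n (A : 'M[R]_(m, n)) : 0 <= spectral_norm A.
Proof. by have := @spectral_norm_ub _ _ A 0; rewrite mulmx0 !l2norm0; apply. Qed.

(** The form of [T] at b x - T x bounds the norm of [T], and |T y - a y|^2 >= 0 that of its
    inverse. *)
Lemma cond_number_le n (T : 'M[R]_n) a b : T^T = T -> 0 < a -> 0 < b ->
  (forall x, a * sqn x <= qf T x <= b * sqn x) -> cond_number T <= b / a.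
Proof.
move=> sT a0 b0 h.
have ha x : a * sqn x <= qf T x by have /andP[] := h x.
have hb x : qf T x <= b * sqn x by have /andP[] := h x.
have Tu := coercive_unit a0 ha.
have n1 : spectral_norm T <= b.
  apply: spectral_norm_le => [|x]; first exact: ltW.
  have : 0 <= qf T (b *: x + (-1) *: (T *m x)).
    by apply: le_trans (ha _); rewrite mulr_ge0 ?sqn_ge0 // ltW.
  rewrite qf_lin // inner_sym // [inner _ _]sqnE.
  have := hb (T *m x); set w := sqn (T *m x) => h1 h2.
  have : b * qf T x <= b * (b * sqn x) by rewrite ler_wpM2l // ltW.
  rewrite -(ler_pM2l b0); nra.
have n2 : spectral_norm (invmx T) <= a^-1.
  apply: spectral_norm_le => [|x]; first by rewrite invr_ge0 ltW.
  rewrite exprVn mulrC ler_pdivlMr ?exprn_gt0 //.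
  set y := invmx T *m x; have -> : x = T *m y by rewrite mulKVmx.
  have : 0 <= sqn (1 *: (T *m y) + (- a) *: y) by exact: sqn_ge0.
  rewrite -[sqn _]qf1 (qf_lin (trmx1 _ _)) !qf1 mul1mx innerC -qf_inner.
  have : a * (a * sqn y) <= a * qf T y by rewrite ler_wpM2l // ltW.
  by nra.
by rewrite /cond_number ler_pM ?spectral_norm_ge0.
Qed.

Lemma posdef_unit n (P : 'M[R]_n) : posdefmx P -> P \in unitmx.
Proof.
move=> [_ h]; rewrite -row_free_unit -kermx_eq0; apply/eqP/row_matrixP => i.
rewrite row0; apply/eqP; apply: contraT => v0.
have := h (row i (kermx P))^T; rewrite trmxK -row_mul mulmx_ker row0 mul0mx mxE ltxx.
apply; apply: contra v0 => /eqP/(congr1 trmx); rewrite trmxK trmx0 => ->.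
by rewrite eqxx.
Qed.

Lemma invsqrt_exists n (P : 'M[R]_n) : posdefmx P -> exists Q, is_invsqrtmx P Q.
Proof.
move=> Pp; have [sP hP] := Pp; have [Q [d [QQ QQ' PE E]]] := funsymP sP.
have d0 i : 0 < d 0 i.
  have := hP (Q^T *m delta_mx i 0).
  have Q1 : Q *m (Q^T *m delta_mx i 0) = delta_mx i 0 :> 'cV_n by rewrite mulmxA QQ' mul1mx.
  have e0 : delta_mx i 0 != 0 :> 'cV[R]_n.
    by apply/negP => /eqP/matrixP/(_ i 0); rewrite !mxE !eqxx => /eqP; rewrite oner_eq0.
  rewrite -/(qf P _) {1}PE qf_spectral Q1 (bigD1 i) //= big1 => [|j ji]; last first.
    by rewrite !mxE (negPf ji) expr0n mulr0.
  rewrite !mxE !eqxx expr1n mulr1 addr0; apply.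
  by apply: contraNneq e0 => h; rewrite -Q1 h mulmx0.
pose f (x : R) := (Num.sqrt x)^-1.
exists (funsym f P); split; first split; first by rewrite E sym_spectral.
  move=> x x0; rewrite -/(qf _ x) E qf_spectral.
  have : 0 < sqn (Q *m x) by rewrite (sqn_orthogonal _ QQ) sqn_gt0.
  move=> /lt0r_neq0/eqP/psumr_neq0P => /(_ (fun i _ => sqr_ge0 _)) [i /andP[_ i0]].
  rewrite (bigD1 i) //= ltr_pwDl //; first by rewrite mxE mulr_gt0 // invr_gt0 sqrtr_gt0.
  by apply: sumr_ge0 => j _; rewrite mxE mulr_ge0 ?sqr_ge0 // invr_ge0 sqrtr_ge0.
have Pu := posdef_unit Pp.
rewrite -[RHS]mul1mx; apply: (canRL (mulmxK Pu)).
rewrite !E mul_spectral // [in X in _ *m X]PE mul_spectral //.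
rewrite (_ : \row_i _ = const_mx 1) ?diag_const_mx ?mulmx1 //.
apply/rowP => i; rewrite !mxE /f -invfM -expr2 sqr_sqrtr ?ltW // mulVf // gt_eqF //.
Qed.

Lemma invsqrt_conj n (P Q : 'M[R]_n) : P \in unitmx -> Q *m Q = invmx P -> Q *m P *m Q = 1%:M.
Proof.
move=> Pu QQ.
have h : Q *m (Q *m P) = 1%:M by rewrite mulmxA QQ mulVmx.
exact: mulmx1C.
Qed.

Lemma precond_cond_le_of_forms n (P M : 'M[R]_n) (a b : R) :
  posdefmx P -> M^T = M -> 0 < a -> 0 < b ->
  (forall x, a * qf P x <= qf M x <= b * qf P x) -> precond_cond_le P M (b / a).
Proof.
move=> Pp sM a0 b0 h; have [Q [[sQ Qp] QQ]] := invsqrt_exists Pp.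
exists Q; split => //.
have QPQ := invsqrt_conj (posdef_unit Pp) QQ.
apply: cond_number_le => //; first by rewrite !trmx_mul sM sQ mulmxA.
move=> x; have := h (Q *m x).
by rewrite -!qf_conj sQ QPQ qf1.
Qed.

End ConditionNumber.

(** * Comparison of the sketched preconditioner with M *)

Section SketchedPreconditioner.
Context {R : realType}.
Variables (N : nat) (A : 'M[R]_N) (S : {set 'I_N}) (mu : R).
Hypotheses (psdA : psdmx A) (mu0 : 0 < mu).

Let E : 'M[R]_(N, #|S|) := cols_of S 1%:M.
Let M := reg_normal_mx A S mu.

Lemma cols_ofE m (B : 'M[R]_(m, N)) : cols_of S B = B *m E.
Proof. by rewrite /E /cols_of mulmx_colsub mulmx1. Qed.

Lemma rows_ofE m (B : 'M[R]_(N, m)) : rows_of S B = E^T *m B.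
Proof.
have -> : E^T = rowsub (fun i : 'I_#|S| => enum_val i) 1%:M.
  by apply/matrixP => i j; rewrite !mxE eq_sym.
by rewrite /rows_of mul_rowsub_mx mul1mx.
Qed.

Lemma qf_gram m n (B : 'M[R]_(m, n)) x : qf (B^T *m B) x = sqn (B *m x).
Proof. by rewrite -sqnE trmx_mul /qf !mulmxA. Qed.

Lemma reg_normal_sym : M^T = M.
Proof.
have [sA _] := psdA.
by rewrite /M /reg_normal_mx linearD /= trmxZ !rows_ofE !cols_ofE !trmx_mul trmxK sA !mulmxA.
Qed.

Lemma qf_reg_normal x : qf M x = sqn (A *m E *m x) + mu * qf A (E *m x).
Proof.
have [sA _] := psdA.
rewrite /M /reg_normal_mx qfD qfZ !rows_ofE !cols_ofE -qf_gram trmx_mul sA.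
by congr (_ + _ * _); rewrite mulmxA -qf_conj.
Qed.

Lemma sketched_precond_sym d (Phi : 'M[R]_(d, N)) :
  (sketched_precond A S mu Phi)^T = sketched_precond A S mu Phi.
Proof.
have [sA _] := psdA.
by rewrite /sketched_precond linearD /= trmxZ !rows_ofE !cols_ofE !trmx_mul !trmxK sA !mulmxA.
Qed.

Lemma qf_sketched_precond d (Phi : 'M[R]_(d, N)) x :
  qf (sketched_precond A S mu Phi) x =
  sqn (Phi *m (A *m E *m x)) + mu * qf A (E *m x).
Proof.
have [sA _] := psdA.
rewrite /sketched_precond qfD qfZ !rows_ofE !cols_ofE [Phi *m _]mulmxA -qf_gram.
congr (_ + _ * _); last by rewrite mulmxA -qf_conj.
by rewrite !trmx_mul sA !mulmxA.
Qed.

Hypothesis Mu : M \in unitmx.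

(** Both terms of [M] have A(:,S) as their right factor, A(S,S) being a row selection of it, so [M]
    would annihilate x too. *)
Lemma cols_inj (x : 'cV[R]_#|S|) : A *m E *m x = 0 -> x = 0.
Proof.
move=> AEx; have : M *m x = 0.
  rewrite /M /reg_normal_mx mulmxDl -scalemxAl !rows_ofE !cols_ofE -!mulmxA.
  by rewrite [A *m (E *m x)]mulmxA AEx !mulmx0 scaler0 addr0.
by move=> Mx; rewrite -[x](mulKmx Mu) Mx mulmx0.
Qed.

Lemma reg_normal_posdef : posdefmx M.
Proof.
split; first exact: reg_normal_sym.
move=> x x0; rewrite -/(qf M x) qf_reg_normal; apply: ltr_pwDl.
  by rewrite sqn_gt0; apply: contraNneq x0 => /cols_inj ->.
by rewrite mulr_ge0 ?(ltW mu0) //; have [_] := psdA; apply.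
Qed.

(* Orthonormalising the columns of A(:,S) turns a subspace embedding for its
   range into a two-sided comparison of P with M. *)
Lemma sketch_embedding_cond :
  exists u : 'I_N -> 'cV[R]_#|S|, cov u (enum 'I_N) = 1%:M /\
    forall d (Phi : 'M[R]_(d, N)),
      (forall v, `|sqn (Phi *m (frame_mx u *m v)) - sqn v| <= 2^-1 * sqn v) ->
      precond_cond_le (sketched_precond A S mu Phi) M 3.
Proof.
have [sA hA] := psdA.
pose B := A *m E; pose G := B^T *m B.
have pG : posdefmx G.
  split; first by rewrite trmx_mul trmxK.
  move=> x x0; rewrite -/(qf G x) qf_gram sqn_gt0.
  by apply: contraNneq x0 => /cols_inj ->.
have [Q [[sQ pQ] QQ]] := invsqrt_exists pG.
have QGQ := invsqrt_conj (posdef_unit pG) QQ.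
have Qu : Q \in unitmx by apply: posdef_unit.
(* U = B (B^T B)^(-1/2) has orthonormal columns and the range of B; its rows are the vectors u_j. *)
pose U := B *m Q.
have UU : U^T *m U = 1%:M by rewrite trmx_mul sQ -QGQ !mulmxA.
exists (fun j => (row j U)^T).
have fU : frame_mx (fun j => (row j U)^T) = U by apply/matrixP => i j; rewrite !mxE.
split.
  rewrite -UU /cov big_enum /=; apply/matrixP => i j; rewrite summxE mxE.
  by apply: eq_bigr => l _; rewrite mxE big_ord_recl big_ord0 addr0 !mxE.
move=> d Phi; rewrite fU => h.
have hB x : `|sqn (Phi *m (B *m x)) - sqn (B *m x)| <= 2^-1 * sqn (B *m x).
  have := h (invmx Q *m x); have -> : U *m (invmx Q *m x) = B *m x.
    by rewrite /U -mulmxA mulKVmx.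
  suff -> : sqn (invmx Q *m x) = sqn (B *m x) by [].
  by rewrite -(sqn_orthogonal _ UU) /U -mulmxA mulKVmx.
(* The term in [mu] is common to both forms and nonnegative, so the factors 1/2 and 3/2 survive its
   addition. *)
have hP x : 2^-1 * qf M x <= qf (sketched_precond A S mu Phi) x <= 3 / 2 * qf M x.
  rewrite qf_reg_normal qf_sketched_precond -/B.
  have : 0 <= mu * qf A (E *m x) by rewrite mulr_ge0 ?(ltW mu0) //; exact: hA.
  have := hB x; rewrite ler_norml => /andP[h1 h2] h3.
  by apply/andP; split; lra.
have [sM pM] := reg_normal_posdef.
have pP : posdefmx (sketched_precond A S mu Phi).
  split; first exact: sketched_precond_sym.
  move=> x /pM x0; have /andP[h1 _] := hP x.
  by apply: lt_le_trans h1; rewrite mulr_gt0.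
(* Inverting the comparison gives (2/3) P <= M <= 2 P. *)
have -> : 3 = 2 / (2 / 3) :> R by field.
apply: precond_cond_le_of_forms => //.
by move=> x; have /andP[h1 h2] := hP x; apply/andP; split; lra.
Qed.

End SketchedPreconditioner.

(** * Conjugate gradients *)

Section Chebyshev.
Context {R : realType}.

(* The pair (T_n x, U_(n-1) x) of Chebyshev polynomials of both kinds. *)
Fixpoint cheb_pair (x : R) n : R * R :=
  if n is m.+1 then
    let p := cheb_pair x m in (x * p.1 + (x ^+ 2 - 1) * p.2, p.1 + x * p.2)
  else (1, 0).

Definition cheb n x := (cheb_pair x n).1.

Lemma cheb_rec n x : cheb n.+2 x = 2 * x * cheb n.+1 x - cheb n x.
Proof. by rewrite /cheb /=; ring. Qed.

(** Pell's identity T^2 - (x^2 - 1) U^2 = 1, in which the second term has a favourable sign on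
    [-1, 1]. *)
Lemma cheb_sqr_le1 n x : -1 <= x <= 1 -> cheb n x ^+ 2 <= 1.
Proof.
move=> /andP[x1 x2].
have pell : (cheb_pair x n).1 ^+ 2 - (x ^+ 2 - 1) * (cheb_pair x n).2 ^+ 2 = 1.
  elim: n => [|n IH] /=; first by ring.
  by rewrite -[RHS]IH; ring.
have : 0 <= (1 - x ^+ 2) * (cheb_pair x n).2 ^+ 2.
  by rewrite mulr_ge0 ?sqr_ge0 //; nra.
by rewrite /cheb; lra.
Qed.

(** At x = 2 the next T is 2 T + 3 U, so the invariant T <= 3 U, valid from n = 1 on, yields growth
    by a factor 3. *)
Lemma cheb2_ge n : 3 ^+ n <= 2 * cheb n 2.
Proof.
have inv m : let p := cheb_pair 2 m.+1 in [/\ 0 <= p.1, 0 <= p.2 & p.1 <= 3 * p.2].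
  elim: m => [|m [h1 h2 h3]]; first by split=> /=; lra.
  by rewrite /=; move: h1 h2 h3; rewrite /=; set p := cheb_pair 2 m => h1 h2 h3; split; lra.
case: n => [|n]; first by rewrite /cheb /=; lra.
elim: n => [|n IH]; first by rewrite /cheb /= expr1; lra.
have [h1 h2 h3] := inv n; rewrite exprS.
have : 3 * 3 ^+ n.+1 <= 3 * (2 * cheb n.+1 2) by rewrite ler_wpM2l.
have -> : cheb n.+2 2 = 2 * (cheb_pair 2 n.+1).1 + (2 ^+ 2 - 1) * (cheb_pair 2 n.+1).2 :> R by [].
by rewrite /cheb; lra.
Qed.

End Chebyshev.

(** * Convergence of preconditioned conjugate gradients *)

Section ConjugateGradient.
Context {R : realType}.

(** Solving the Galerkin system in a basis of [V] makes the error M-orthogonal to [V]; Pythagoras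
    then gives minimality. *)
Lemma energy_minimizer n (M : 'M[R]_n) (V : {vspace 'cV[R]_n}) (beta : 'cV[R]_n) :
  posdefmx M -> exists2 w, w \in V &
    forall w', w' \in V -> energy_norm M (w - beta) <= energy_norm M (w' - beta).
Proof.
move=> [sM pM]; pose X := vbasis V.
pose B : 'M[R]_(n, \dim V) := \matrix_(i, j) X`_j i 0.
have BE c : B *m c = \sum_j c j 0 *: X`_j.
  apply/matrixP => i j; rewrite ord1 mxE summxE; apply: eq_bigr => l _.
  by rewrite !mxE mulrC.
have BV c : B *m c \in V.
  by rewrite BE; apply: memv_suml => j _; rewrite memvZ // vbasis_mem // mem_nth // size_tuple.
have VB w : w \in V -> exists c, w = B *m c.
  move=> wV; exists (\col_j coord X j w); rewrite BE {1}(coord_vbasis wV).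
  by apply: eq_bigr => j _; rewrite mxE.
pose G := B^T *m M *m B.
have pG : posdefmx G.
  split; first by rewrite /G !trmx_mul trmxK sM mulmxA.
  move=> c c0; rewrite -/(qf G c) /G qf_conj; apply: pM.
  apply: contraNneq c0 => Bc; apply/eqP/matrixP => j l; rewrite ord1 mxE.
  have /freeP/(_ (fun j => c j 0)) := basis_free (vbasisP V); apply.
  by rewrite -BE.
have Gu := posdef_unit pG.
pose c := invmx G *m (B^T *m (M *m beta)).
exists (B *m c) => // _ /VB[c' ->].
have orth e : inner (B *m e) (M *m (B *m c - beta)) = 0.
  rewrite /inner trmx_mul -mulmxA mulmxBr mulmxBr.
  have -> : B^T *m (M *m (B *m c)) = G *m c by rewrite /G !mulmxA.
  by rewrite /c mulKVmx // subrr mulmx0 mxE.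
rewrite !energy_normE; apply: ler_wsqrtr.
have -> : B *m c' - beta = 1 *: (B *m (c' - c)) + 1 *: (B *m c - beta).
  by rewrite !scale1r mulmxBr addrA subrK.
rewrite (qf_lin sM) orth mulr0 addr0 expr1n !mul1r lerDr.
have [->|e0] := eqVneq (B *m (c' - c)) 0; last exact/ltW/pM.
by rewrite /qf mulmx0 mxE.
Qed.

Lemma krylov_sub n (P M : 'M[R]_n) b t v : v \in krylov P M b t -> v \in krylov P M b t.+1.
Proof.
apply: subvP; apply: sub_span => x; rewrite /krylov => /mapP[j]; rewrite mem_iota => /andP[_ jt] ->.
by apply/mapP; exists j => //; rewrite mem_iota /= add0n ltnS ltnW.
Qed.

Lemma krylov0 n (P M : 'M[R]_n) b t : invmx P *m b \in krylov P M b t.+1.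
Proof.
apply: memv_span; apply/mapP; exists 0%N; first by rewrite mem_iota.
by rewrite expr0 mul1mx.
Qed.

Lemma krylov_mul n (P M : 'M[R]_n) b t v :
  v \in krylov P M b t -> invmx P *m M *m v \in krylov P M b t.+1.
Proof.
rewrite /krylov -[X in <<X>>%VS]in_tupleE => /coord_span ->.
rewrite mulmx_sumr; apply: memv_suml => i _; rewrite -scalemxAr memvZ // memv_span //.
have it : (i < t)%N by have := ltn_ord i; rewrite [X in (_ < X)%N]size_map size_iota.
rewrite (nth_map 0%N) ?size_iota // nth_iota // add0n.
apply/mapP; exists i.+1; first by rewrite mem_iota.
by rewrite exprS -mulmxE -[RHS]mulmxA.
Qed.

Lemma cond_number_eigen n (T : 'M[R]_n) (O : 'M[R]_n) (d : 'rV[R]_n) c :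
  O^T *m O = 1%:M -> O *m O^T = 1%:M -> T = O^T *m diag_mx d *m O ->
  (forall i, 0 < d 0 i) -> cond_number T <= c -> forall i j, d 0 j <= c * d 0 i.
Proof.
move=> OO OO' TE d0 hc i j.
pose e i : 'cV[R]_n := O^T *m delta_mx i 0.
have Oe l : O *m e l = delta_mx l 0 by rewrite mulmxA OO' mul1mx.
have ne l : l2norm (e l) = 1.
  rewrite l2normE -(sqn_orthogonal _ OO) Oe /sqn (bigD1 l) //= big1 => [|a al].
    by rewrite !mxE !eqxx expr1n addr0 sqrtr1.
  by rewrite !mxE (negPf al) expr0n.
have nZ (a : R) l : 0 <= a -> l2norm (a *: e l) = a.
  by move=> a0; rewrite l2normE sqn_scale sqrtrM ?sqr_ge0 // sqrtr_sqr ger0_norm // -l2normE ne mulr1.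
have Te l : T *m e l = d 0 l *: e l.
  rewrite TE -!mulmxA Oe scalemxAr; congr (_ *m _).
  apply/matrixP => a b; rewrite mul_diag_mx !mxE.
  by case: eqVneq => [->|_] //; rewrite !mulr0.
have di0 := d0 i; have dj0 := d0 j.
have h1 : d 0 j <= spectral_norm T.
  rewrite -(nZ (d 0 j) j) ?(ltW dj0) // -Te.
  by apply: spectral_norm_ub; rewrite ne.
have Tu : T \in unitmx.
  have sT : T^T = T by rewrite TE sym_spectral.
  apply: posdef_unit; split=> // x x0; rewrite -/(qf T x) TE qf_spectral.
  have : 0 < sqn (O *m x) by rewrite (sqn_orthogonal _ OO) sqn_gt0.
  move=> /lt0r_neq0/eqP/psumr_neq0P => /(_ (fun i _ => sqr_ge0 _)) [l /andP[_ l0]].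
  rewrite (bigD1 l) //=; apply: ltr_pwDl; first exact: mulr_gt0.
  by apply: sumr_ge0 => m _; rewrite mulr_ge0 ?sqr_ge0 // ltW.
have h2 : (d 0 i)^-1 <= spectral_norm (invmx T).
  have E : invmx T *m e i = (d 0 i)^-1 *: e i.
    apply: (canLR (mulKmx Tu)).
    by rewrite -scalemxAr Te scalerA mulVf ?scale1r // gt_eqF.
  rewrite -(nZ (d 0 i)^-1 i) ?invr_ge0 ?(ltW di0) // -E.
  by apply: spectral_norm_ub; rewrite ne.
rewrite -ler_pdivrMr //; apply: le_trans hc.
by apply: ler_pM => //; rewrite ?invr_ge0 ltW.
Qed.

(** The iterate competes with w = beta - T_t (2 - L / a) beta / T_t (2), where L = P^-1 M, T_t is
    the Chebyshev polynomial and a the least eigenvalue of Q M Q. The error polynomial is 1 at 0, so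
    w lies in the Krylov space, and it is at most 1 / T_t (2) in absolute value on [a, 3a], which
    contains the spectrum. *)
Theorem pcg_error_le n (P M : 'M[R]_n) (beta : 'cV[R]_n) t :
  posdefmx M -> precond_cond_le P M 3 ->
  energy_norm M (pcg_iterate P M (M *m beta) t - beta) <= 2 / 3 ^+ t * energy_norm M beta.
Proof.
move=> pM [Q [[pQ QQ] hc]]; have [sM _] := pM; have [sQ _] := pQ.
have Qu := posdef_unit pQ.
pose T := Q *m M *m Q.
have sT : T^T = T by rewrite /T !trmx_mul sM sQ mulmxA.
have [W [d [WW WW' TE _]]] := funsymP sT.
have MQ x : qf M (Q *m x) = qf T x by rewrite -qf_conj sQ.
have d0 i : 0 < d 0 i.
  have e0 : delta_mx i 0 != 0 :> 'cV[R]_n.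
    by apply/negP => /eqP/matrixP/(_ i 0); rewrite !mxE !eqxx => /eqP; rewrite oner_eq0.
  have W1 : W *m (W^T *m delta_mx i 0) = delta_mx i 0 :> 'cV_n by rewrite mulmxA WW' mul1mx.
  have : 0 < qf M (Q *m (W^T *m delta_mx i 0)).
    have [_ pM'] := pM; apply: pM'; apply: contraNneq e0 => h.
    by rewrite -W1 -[W^T *m _](mulKmx Qu) h !mulmx0.
  rewrite MQ TE qf_spectral W1 (bigD1 i) //= big1 => [|j ji]; last first.
    by rewrite !mxE (negPf ji) expr0n mulr0.
  by rewrite !mxE !eqxx expr1n mulr1 addr0.
have dd := cond_number_eigen WW WW' TE d0 hc.
have [a a0 ha] : exists2 a, 0 < a & forall i, a <= d 0 i <= 3 * a.
  (* In dimension 0 there is no least eigenvalue, and any a > 0 serves. *)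
  have [n0|[i0]] : n = 0%N \/ inhabited 'I_n.
    by case: (n) => [|m]; [left | right; constructor; exact: ord0].
  - by exists 1 => // i; have := ltn_ord i; rewrite [X in (_ < X)%N]n0.
  - have [i _ hi] := Order.TotalTheory.arg_minP (fun i => d 0 i) (isT : xpredT i0).
    by exists (d 0 i) => // j; rewrite hi // dd.
pose y := W *m (invmx Q *m beta).
pose L := invmx P *m M.
have LQ x : L *m (Q *m x) = Q *m (T *m x) by rewrite /L -QQ /T !mulmxA.
(* This affine map sends [a, 3a] onto [-1, 1] and 0 to 2. *)
pose x i := 2 - d 0 i / a.
(* [tau m] is T_m (2 - L / a) beta in the eigenbasis, where its energy is evident; the recurrence
   [tauS] serves for Krylov membership. *)
pose tau m := Q *m (W^T *m \col_i (cheb m (x i) * y i 0)).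
have tau0 : tau 0%N = beta.
  rewrite /tau (_ : \col_i _ = y); first by rewrite /y !mulmxA -(mulmxA Q) WW mulmx1 mulmxV // mul1mx.
  by apply/matrixP => i j; rewrite ord1 mxE mul1r.
have Ltau (z : 'cV[R]_n) : L *m (Q *m (W^T *m z)) = Q *m (W^T *m \col_i (d 0 i * z i 0)).
  rewrite LQ TE -!mulmxA [W *m _]mulmxA WW' mul1mx; congr (_ *m (_ *m _)).
  by apply/matrixP => i j; rewrite ord1 mul_diag_mx !mxE.
pose X (v : 'cV[R]_n) := 2 *: v - a^-1 *: (L *m v).
have Xtau (z : 'cV[R]_n) : X (Q *m (W^T *m z)) = Q *m (W^T *m \col_i (x i * z i 0)).
  rewrite /X Ltau 4!scalemxAr -mulmxBr -mulmxBr; congr (_ *m (_ *m _)).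
  by apply/matrixP => i j; rewrite ord1 !mxE /x; ring.
have tau1 : tau 1%N = X beta.
  rewrite -tau0 Xtau; congr (_ *m (_ *m _)); apply/matrixP => i j.
  by rewrite ord1 !mxE /cheb /=; ring.
have tauS m : tau m.+2 = 2 *: X (tau m.+1) - tau m.
  rewrite Xtau 2!scalemxAr -mulmxBr -mulmxBr; congr (_ *m (_ *m _)).
  by apply/matrixP => i j; rewrite ord1 !mxE cheb_rec; ring.
pose K m := krylov P M (M *m beta) m.
have Lbeta m : L *m beta \in K m.+1 by rewrite /L -mulmxA; exact: krylov0.
have KX m v : v \in K m -> X v \in K m.+1.
  by move=> vK; rewrite memvB // memvZ //; [exact: krylov_sub | exact: krylov_mul].
(* Two consecutive indices are carried for the three-term recurrence. Subtracting T_m (2) beta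
   removes the constant term in L, and L beta = P^-1 b starts the Krylov space. *)
have memK m : (tau m - cheb m 2 *: beta \in K m) /\ (tau m.+1 - cheb m.+1 2 *: beta \in K m.+1).
  elim: m => [|m [IH1 IH2]].
    rewrite tau0 tau1 /cheb /= scale1r subrr mem0v; split => //.
    rewrite /X (_ : _ - _ = - (a^-1 *: (L *m beta))) ?rpredN ?memvZ //.
    by apply/matrixP => i j; rewrite !mxE; ring.
  split => //.
  have -> : tau m.+2 - cheb m.+2 2 *: beta = 2 *: X (tau m.+1 - cheb m.+1 2 *: beta)
     - (tau m - cheb m 2 *: beta) - (2 * cheb m.+1 2 / a) *: (L *m beta).
    rewrite tauS cheb_rec /X mulmxBr -scalemxAr.
    by apply/matrixP => i j; rewrite !mxE; ring.
  apply: memvB; last exact: memvZ.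
  apply: memvB; first by apply: memvZ; exact: KX.
  by do 2!apply: krylov_sub.
have [IH _] := memK t.
have energy_tau m : energy_norm M (tau m) <= energy_norm M beta.
  rewrite -[in leRHS]tau0 !energy_normE; apply: ler_wsqrtr.
  rewrite !MQ TE !qf_spectral !mulmxA WW' !mul1mx; apply: ler_sum => i _.
  rewrite !mxE ler_wpM2l ?(ltW (d0 i)) // mul1r exprMn ler_piMl ?sqr_ge0 //.
  apply: cheb_sqr_le1; have /andP[h1 h2] := ha i.
  have g1 : 1 <= d 0 i / a by rewrite ler_pdivlMr // mul1r.
  have g2 : d 0 i / a <= 3 by rewrite ler_pdivrMr.
  by rewrite /x; apply/andP; split; lra.
have c2 := cheb2_ge (R := R) t.
have c0 : 0 < cheb t 2 :> R.
  by have : 0 < 3 ^+ t :> R; [rewrite exprn_gt0 | lra].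
pose w := beta - (cheb t 2)^-1 *: tau t.
have wK : w \in K t.
  have -> : w = (- (cheb t 2)^-1) *: (tau t - cheb t 2 *: beta).
    by rewrite scalerBr scalerA mulNr mulVf ?gt_eqF // scaleN1r opprK addrC scaleNr.
  by rewrite memvZ.
have Mb : invmx M *m (M *m beta) = beta by rewrite mulKmx // posdef_unit.
(* A minimiser exists, so the default value of [xget] is ruled out. *)
have pcgP : is_pcg_iterate P M (M *m beta) t (pcg_iterate P M (M *m beta) t).
  have [w0 w0K hw0] := energy_minimizer (K t) beta pM.
  by apply: (@xgetPex _ 0); exists w0; split=> // w' w'K; rewrite Mb; exact: hw0.
have [_ /(_ w wK)] := pcgP; rewrite Mb => h; apply: (le_trans h).
have -> : w - beta = (- (cheb t 2)^-1) *: tau t.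
  by rewrite /w addrAC subrr add0r scaleNr.
have -> : energy_norm M (- (cheb t 2)^-1 *: tau t) = (cheb t 2)^-1 * energy_norm M (tau t).
  rewrite !energy_normE qf_scale sqrrN sqrtrM ?sqr_ge0 // sqrtr_sqr ger0_norm //.
  by rewrite invr_ge0 ltW.
apply: ler_pM => //; first by rewrite invr_ge0 ltW.
  exact: sqrtr_ge0.
rewrite -[leRHS]invrK lef_pV2 ?posrE ?invr_gt0 ?divr_gt0 ?exprn_gt0 //.
by rewrite invf_div ler_pdivrMr // mulrC.
Qed.

End ConjugateGradient.

(** * The failure probability *)

Lemma sign_seeds_gt0 d N zeta : (zeta <= d)%N -> (0 < #|sign_seeds d N zeta|)%N.
Proof.
move=> zd; apply/card_gt0P.
exists [ffun=> ([set i : 'I_d | (i < zeta)%N], [ffun=> false])].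
rewrite inE; apply/forallP => j; rewrite ffunE /= cardsE -sum1_card.
by rewrite -(big_ord_widen d (fun=> 1%N) zd) sum_nat_const card_ord muln1.
Qed.

Lemma sparse_sign_prob_ge (R : realType) d N zeta (E F : 'M[R]_(d, N) -> Prop) (delta : R) :
  (zeta <= d)%N -> (forall Phi, F Phi -> E Phi) ->
  #|[set s in sign_seeds d N zeta | ~~ `[< F (sparse_sign_mx R zeta s) >]]|%:R
    <= delta * #|sign_seeds d N zeta|%:R ->
  1 - delta <= sparse_sign_prob zeta E.
Proof.
move=> zd FE h; have n0 : 0 < #|sign_seeds d N zeta|%:R :> R by rewrite ltr0n sign_seeds_gt0.
rewrite /sparse_sign_prob ler_pdivlMr // mulrBl mul1r lerBlDl.
apply: le_trans (lerD h (lexx _)); rewrite -natrD ler_nat.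
rewrite -(cardsID [set s | `[< E (sparse_sign_mx R zeta s) >]] (sign_seeds d N zeta)) addnC.
apply: leq_add; apply: subset_leq_card; apply/fintype.subsetP => s; rewrite !inE.
  by case/andP => nE ->; apply: contra nE => /asboolP Fs; apply/asboolP/FE.
by [].
Qed.

Theorem theorem2 (R : realType) :
  exists (C : R) (zeta d : nat -> R -> nat),
    [/\ 0 < C,
        forall (k : nat) (delta : R), (1 <= k)%N -> 0 < delta < 1 ->
          [/\ (0 < zeta k delta)%N,
              (zeta k delta <= d k delta)%N,
              (zeta k delta)%:R <= C * (1 + ln (k%:R / delta)) &
              (d k delta)%:R <= C * k%:R * (1 + ln (k%:R / delta))] &
        forall (delta eps : R) (N : nat) (A : 'M[R]_N) (S : {set 'I_N})
               (k : nat) (mu : R),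
          0 < delta < 1 -> 0 < eps < 1 ->
          psdmx A -> #|S| = k -> (1 <= k)%N -> 0 < mu ->
          let M := reg_normal_mx A S mu in
          M \in unitmx ->
          let P (Phi : 'M[R]_(d k delta, N)) := sketched_precond A S mu Phi in
          1 - delta <= sparse_sign_prob (zeta k delta)
                         (fun Phi => precond_cond_le (P Phi) M 3) /\
          forall s : sign_seed (d k delta) N,
            s \in sign_seeds (d k delta) N (zeta k delta) ->
            let Phi := sparse_sign_mx R (zeta k delta) s in
            precond_cond_le (P Phi) M 3 ->
            forall (y : 'cV[R]_N),
              let b := rows_of S A *m y in
              let beta := invmx M *m b in
              forall t : nat, ln (2 / eps) <= t%:R ->
                energy_norm M (pcg_iterate (P Phi) M b t - beta)
                  <= eps * energy_norm M beta].
Proof.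
(* 2^-21 K / 8 = 1, so exp (2^-21 zeta / 8) is at least exp (ln (k / delta) + 2); the summand 2
   absorbs the factor 4 of the union bound, as exp 2 >= 4. *)
pose K : R := 2 ^+ 24.
have K1 : 1 <= K by rewrite exprn_ege1 // ler1n.
pose x (k : nat) (delta : R) := K * (ln (k%:R / delta) + 2).
pose zeta k delta := (Num.truncn (x k delta)).+1.
(* With L = ln (k / delta) >= 0, zeta <= K L + 2 K + 1 <= 4 K (1 + L), and d = 2 k zeta doubles the
   constant. *)
exists (2 ^+ 3 * K), zeta, (fun k delta => (k * zeta k delta + k * zeta k delta)%N).
have L0 (k : nat) (delta : R) : (1 <= k)%N -> 0 < delta < 1 -> 0 <= ln (k%:R / delta).
  move=> k1 /andP[d0 d1]; apply: ln_ge0; rewrite ler_pdivlMr // mul1r.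
  by rewrite (le_trans (ltW d1)) // ler1n.
have x0 (k : nat) (delta : R) : (1 <= k)%N -> 0 < delta < 1 -> 0 <= x k delta.
  by move=> k1 hd; rewrite mulr_ge0 ?addr_ge0 ?L0 // (le_trans ler01).
have zle (k : nat) (delta : R) : (1 <= k)%N -> 0 < delta < 1 ->
    (zeta k delta)%:R <= 4 * K * (1 + ln (k%:R / delta)).
  move=> k1 hd; rewrite /zeta -natr1.
  have h : (Num.truncn (x k delta))%:R <= x k delta by rewrite truncn_le x0.
  have := L0 _ _ k1 hd; move: h; rewrite /x; set L := ln _ => h L00.
  have : 0 <= K * L by rewrite mulr_ge0 // (le_trans ler01).
  by lra.
split.
- by rewrite mulr_gt0 ?exprn_gt0.
- move=> k delta k1 hd; have k0 : 0 < k%:R :> R by rewrite ltr0n.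
  have h := zle _ _ k1 hd; have h0 := L0 _ _ k1 hd.
  have KL : 0 <= K * (1 + ln (k%:R / delta)) by rewrite mulr_ge0 ?addr_ge0 // (le_trans ler01).
  split=> //.
  + by rewrite -{1}[zeta k delta]mul1n (leq_trans _ (leq_addr _ _)) // leq_mul2r k1 orbT.
  + by lra.
  + rewrite natrD natrM.
    have : k%:R * (zeta k delta)%:R <= k%:R * (4 * K * (1 + ln (k%:R / delta))).
      by rewrite ler_wpM2l // ltW.
    by lra.
move=> delta eps N A S k mu hd heps psdA Sk k1 mu0 M Mu P; subst k; split; last first.
  move=> s _ Phi hc y b beta t ht.
  have pM := reg_normal_posdef psdA mu0 Mu.
  have -> : b = M *m beta by rewrite /beta mulKVmx.
  apply: (le_trans (pcg_error_le beta t pM hc)); rewrite ler_wpM2r ?sqrtr_ge0 //.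
  have /andP[e0 e1] := heps.
  rewrite ler_pdivrMr ?exprn_gt0 // -ler_pdivrMl // mulrC.
  rewrite -[leLHS]lnK ?posrE ?divr_gt0 //.
  (* 3^t >= exp t >= 2 / eps. *)
  apply: (@le_trans _ _ (expR t%:R)); first by rewrite ler_expR.
  by rewrite -[t%:R]mulr1 expRM_natl lerXn2r ?nnegrE ?expR_ge0 ?expR1_le3.
have [u [covu hu]] := sketch_embedding_cond psdA mu0 Mu.
apply: (sparse_sign_prob_ge (F := fun Phi => forall v,
   `|sqn (Phi *m (frame_mx u *m v)) - sqn v| <= 2^-1 * sqn v)) => [|Phi|].
- by rewrite -{1}[zeta _ _]mul1n (leq_trans _ (leq_addr _ _)) // leq_mul2r k1 orbT.
- exact: hu.
have /andP[d0 d1] := hd.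
set z := zeta _ delta; set B := #|_|%:R; set n := #|sign_seeds _ _ _|%:R.
have := count_bad_sketch covu k1 (isT : (0 < z)%N) erefl; rewrite -/B -/n => h.
have k0 : 0 < #|S|%:R :> R by rewrite ltr0n.
have zx : x #|S| delta <= z%:R by apply: ltW; rewrite truncnS_gt.
have c8 : (2 ^- 21 : R) * K = 8.
  by rewrite /K (exprD 2 21 3) mulKf ?expf_neq0 // -natrX.
have e1 : 4 * #|S|%:R / delta <= expR (2 ^- 21 * z%:R / 8).
  have e2 : 4 <= expR 2 :> R.
    have h2 : 2 <= expR 1 :> R by have := expR_ge1Dx (1 : R); lra.
    have -> : expR 2 = expR 1 ^+ 2 :> R by rewrite -expRM_natl mulr1.
    by rewrite expr2; nra.
  apply: (@le_trans _ _ (expR (ln (#|S|%:R / delta) + 2))).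
    rewrite expRD lnK ?posrE ?divr_gt0 // -mulrA [leLHS]mulrC.
    by apply: ler_wpM2l e2; rewrite divr_ge0 // ltW.
  rewrite ler_expR ler_pdivlMr // -c8.
  have -> : (ln (#|S|%:R / delta) + 2) * (2 ^- 21 * K) = 2 ^- 21 * x #|S| delta.
    by rewrite /x; ring.
  by rewrite ler_wpM2l // invr_ge0 exprn_ge0.
have ez := expR_gt0 (2 ^- 21 * z%:R / 8 : R).
rewrite -(ler_pM2r ez) (le_trans h) //.
rewrite [leRHS]mulrAC ler_wpM2r //.
by rewrite [leRHS]mulrC -ler_pdivrMr.
Qed.
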